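(* Suppose Assumptions A and C (stated in the context) hold. Then for $\tau$ and $h$ small enough there exists a unique solution $\{u_h^n,v_h^{*,n},v_h^n\}_{n=1}^N$ to the fully-discrete scheme (stated in the context), and there is a constant $Q>0$, independent of $\tau$, $h$, $n$ and $N$, such that for $1\le n\le N$ $$\|\nabla u_h^n\|+\|\nabla v_h^n\|+\|\nabla v_h^{*,n}\|\le Q,\qquad \big|\|v_h^{*,n}\|-1\big|\le\big|\|v_h^{*,n}\|^2-1\big|\le Q\tau.$$
   Context: $\Omega\subset\mathbb R^d$ ($1\le d\le3$) is a bounded domain with smooth boundary; $(\cdot,\cdot)$, $\|\cdot\|$ are the $L^2(\Omega)$ inner product and norm; $\beta,\gamma,T>0$ are fixed. The initial data are $u_0,v_0\in H^2(\Omega)\cap H^1_0(\Omega)$ with $\|v_0\|=1$. For mesh size $h$, $S_h\subset H^1_0(\Omega)$ is the space of continuous piecewise linear functions on a quasi-uniform partition of $\Omega$ of mesh size $h$, and $P:H^1_0(\Omega)\to S_h$ is the elliptic projection, $(\nabla(g-Pg),\nabla\chi)=0$ for all $\chi\in S_h$, which satisfies $\|g-Pg\|+h\|\nabla(g-Pg)\|\le Qh^2\|g\|_{H^2}$ for all $g\in H^2(\Omega)\cap H^1_0(\Omega)$ with $Q$ independent of $h$ and $g$. Let $N$ be a positive integer, $\tau=T/N$, $t_n=n\tau$. Fully-discrete scheme: with $u_h^0=Pu_0$ and $v_h^0=Pv_0/\|Pv_0\|$, for $n=1,\dots,N$ find $u_h^n,v_h^{*,n},v_h^n\in S_h$ such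 that for all $\chi_1,\chi_2\in S_h$ $$\beta^{-1}\Big(\frac{u_h^n-u_h^{n-1}}{\tau},\chi_1\Big)+(\nabla u_h^n,\nabla\chi_1)-2(v_h^{n-1},\chi_1)(\nabla v_h^{n-1},\nabla u_h^n)=(f(u_h^{n-1}),\chi_1)-2(v_h^{n-1},\chi_1)(f(u_h^{n-1}),v_h^{n-1}),$$ $$\gamma^{-1}\Big(\frac{v_h^{*,n}-v_h^{n-1}}{\tau},\chi_2\Big)+(\nabla v_h^{*,n},\nabla\chi_2)-(v_h^{n-1},\chi_2)(\nabla v_h^{n-1},\nabla v_h^{*,n})=(f'(u_h^{n-1})v_h^{n-1},\chi_2)-(v_h^{n-1},\chi_2)(f'(u_h^{n-1})v_h^{n-1},v_h^{n-1}),$$ $$v_h^n=v_h^{*,n}/\|v_h^{*,n}\|.$$ Assumption A: $f$ and $f'$ are locally Lipschitz on $\mathbb R$: for every $r>0$ there is $L_r>0$ with $|f(z_1)-f(z_2)|+|f'(z_1)-f'(z_2)|\le L_r|z_1-z_2|$ for all $-r\le z_1,z_2\le r$. Assumption C: there exist $h_0,\tau_0,C_1>0$ such that for any $0<h<h_0$ and $0<\tau<\tau_0$ the solution $u_h^n$ of the fully-discrete scheme, if it exists, satisfies $\max_{0\le n\le N}\|u_h^n\|_{L^\infty(\Omega)}\le C_1$; this is understood also for solutions existing only up to some time level $m\le N$, i.e. then $\max_{0\le n\le m}\|u_h^n\|_{L^\infty(\Omega)}\le C_1$. The constant $Q$ may depend on $T$, the data ($\Omega,f,\beta,\gamma,u_0,v_0$)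 and $C_1$. *)

(* Defs.v *)
(* MathComp and MathComp-Analysis, over an arbitrary [R : realType]; points of
   R^d are row vectors ['rV[R]_d].  Elements of L^2, H^1_0, H^2 are represented
   by (Borel measurable on Omega) functions ['rV[R]_d -> R].                  *)
From HB Require Import structures.
From mathcomp Require Import all_boot all_order all_algebra.
From mathcomp Require Import all_classical all_reals all_analysis.

Set Implicit Arguments.
Unset Strict Implicit.
Unset Printing Implicit Defensive.

Import Order.TTheory GRing.Theory Num.Theory numFieldNormedType.Exports.

Local Open Scope classical_set_scope.
Local Open Scope ring_scope.

(* The library has binary product measures and the product sigma-algebra on
   tuples, but no d-fold product of sigma-finite measures, so Lebesgue measure
   on R^d is built by recursion on d, transporting [lebesgue_measure \x m] from
   R * R^n to R^(n.+1).                                                       *)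

Definition cons_tup (R : realType) n
    (p : measurableTypeR R * n.-tuple (measurableTypeR R)) :
  n.+1.-tuple (measurableTypeR R) := [tuple of p.1 :: p.2].

Definition uncons_tup (R : realType) n
    (t : n.+1.-tuple (measurableTypeR R)) :
  measurableTypeR R * n.-tuple (measurableTypeR R) :=
  (thead t, [tuple of behead t]).

Lemma measurable_cons_tup (R : realType) n :
  measurable_fun setT (@cons_tup R n).
Proof. exact: measurable_cons. Qed.

Lemma measurable_uncons_tup (R : realType) n :
  measurable_fun setT (@uncons_tup R n).
Proof.
apply/measurable_fun_pairP; split => /=.
  exact: (@measurable_tnth _ (measurableTypeR R) n.+1 ord0).
exact: measurable_behead.
Qed.

Lemma cons_tupK (R : realType) n : cancel (@cons_tup R n) (@uncons_tup R n).
Proof. by case=> x t; congr pair; apply: val_inj. Qed.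

Section cons_measure.
Context (R : realType) (n : nat).
Variable m : {sigma_finite_measure set (n.-tuple (measurableTypeR R)) -> \bar R}.
Local Open Scope ereal_scope.

Definition cons_measure : set (n.+1.-tuple (measurableTypeR R)) -> \bar R :=
  pushforward (@lebesgue_measure R \x m) (@cons_tup R n).

Let cons_measure0 : cons_measure set0 = 0.
Proof. by rewrite /cons_measure /pushforward preimage_set0 measure0. Qed.

Let cons_measure_ge0 A : 0 <= cons_measure A.
Proof. by rewrite /cons_measure /pushforward measure_ge0. Qed.

Let cons_measure_sigma_additive : semi_sigma_additive cons_measure.
Proof.
move=> F mF tF mUF; rewrite /cons_measure /pushforward preimage_bigcup.
have mc := @measurable_cons_tup R n.
apply: measure_semi_sigma_additive.
- by move=> k; rewrite -[X in measurable X]setTI; exact: mc.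
- apply/trivIsetP => /= i j _ _ ij; rewrite -preimage_setI.
  by move/trivIsetP : tF => /(_ _ _ _ _ ij) ->//; rewrite preimage_set0.
- by rewrite -preimage_bigcup -[X in measurable X]setTI; exact: mc.
Qed.

HB.instance Definition _ := isMeasure.Build _ _ _ cons_measure
  cons_measure0 cons_measure_ge0 cons_measure_sigma_additive.

Let cons_measure_sigma_finite : sigma_finite setT cons_measure.
Proof.
have /sigma_finiteP[F [TF ndF Foo]] := sigma_finiteT (@lebesgue_measure R).
have /sigma_finiteP[G [TG ndG Goo]] := sigma_finiteT m.
exists (fun k => @uncons_tup R n @^-1` (F k `*` G k)).
  rewrite -preimage_bigcup (_ : \bigcup_k _ = setT) ?preimage_setT//.
  apply/seteqP; split=> // -[x y] _.
  have [j _ Fx] : (\bigcup_k F k) x by rewrite -TF.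
  have [k _ Gy] : (\bigcup_k G k) y by rewrite -TG.
  exists (maxn j k) => //; split => /=.
    by move: x Fx; exact/subsetPset/ndF/leq_maxl.
  by move: y Gy; exact/subsetPset/ndG/leq_maxr.
move=> k; have [mF Fk] := Foo k; have [mG Gk] := Goo k; split.
  rewrite -[X in measurable X]setTI.
  by apply: measurable_uncons_tup => //; exact: measurableX.
rewrite /cons_measure /pushforward (_ : _ @^-1` _ = F k `*` G k).
  by rewrite product_measure1E// lte_mul_pinfty// ge0_fin_numE.
by apply/funext => p; rewrite /preimage /mkset cons_tupK.
Qed.

HB.instance Definition _ := @Measure_isSigmaFinite.Build _ _ _ cons_measure
  cons_measure_sigma_finite.

End cons_measure.

Fixpoint lebesgue_tuple (R : realType) (d : nat) :
    {sigma_finite_measure set (d.-tuple (measurableTypeR R)) -> \bar R} :=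
  match d with
  | 0 => @dirac _ (0.-tuple (measurableTypeR R)) [tuple] R
  | n.+1 => cons_measure (lebesgue_tuple R n)
  end.

Section sobolev.
Context (R : realType) (d : nat).
Local Notation V := 'rV[R]_d.
Local Notation leb := (lebesgue_tuple R d).
Implicit Types (Omega : set V) (u w : V -> R) (G : 'I_d -> V -> R).

Definition vec (t : d.-tuple (measurableTypeR R)) : V := \row_i tnth t i.

Definition eucl_norm (x : V) : R := Num.sqrt (\sum_i x 0 i ^+ 2).

Definition boundary (A : set V) : set V := closure A `\` A°.

Definition partial (i : 'I_d) u : V -> R := fun x => 'D_(delta_mx 0 i) u x.

Fixpoint Ck (k : nat) u : Prop :=
  continuous u /\
  match k with
  | 0 => True
  | k'.+1 => forall i, (forall x, derivable u x (delta_mx 0 i)) /\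
                       Ck k' (partial i u)
  end.

Definition smooth u : Prop := forall k, Ck k u.

(* Smoothness of the boundary: near each of its points, Omega is one side of a
   regular level set of a C^oo function.                                      *)
Record smooth_bounded_domain Omega : Prop := {
  domain_nonempty : Omega !=set0;
  domain_open : open Omega;
  domain_connected : connected Omega;
  domain_bounded : bounded_set Omega;
  domain_smooth : forall x0, boundary Omega x0 ->
    exists phi : V -> R, [/\ smooth phi,
      exists i, partial i phi x0 != 0 &
      \forall x \near x0, Omega x <-> phi x < 0] }.

Definition L2 Omega u : Prop :=
  measurable_fun (vec @^-1` Omega) (u \o vec) /\
  leb.-integrable (vec @^-1` Omega) (fun t => (u (vec t) ^+ 2)%:E).

Definition L2_inner Omega u w : R :=
  \int[leb]_(t in vec @^-1` Omega) (u (vec t) * w (vec t)).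

Definition L2_norm Omega u : R := Num.sqrt (L2_inner Omega u u).

Definition Linf_norm Omega u : \bar R :=
  'N[leb]_+oo [(fun t => (u (vec t))%:E) \_ (vec @^-1` Omega)]%E.

Definition L2v_inner Omega G H : R := \sum_i L2_inner Omega (G i) (H i).

Definition L2v_norm Omega G : R := Num.sqrt (L2v_inner Omega G G).

Definition test_function Omega phi : Prop :=
  smooth phi /\
  exists K : set V, [/\ compact K, K `<=` Omega & forall x, ~ K x -> phi x = 0].

Definition weak_partial Omega (i : 'I_d) u g : Prop :=
  forall phi, test_function Omega phi ->
    L2_inner Omega u (partial i phi) = - L2_inner Omega g phi.

Definition weak_gradient Omega u G : Prop :=
  L2 Omega u /\ forall i, L2 Omega (G i) /\ weak_partial Omega i u (G i).

(* u is in H^1_0(Omega), the H^1-closure of C_c^oo(Omega), with gradient G. *)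
Definition H10_gradient Omega u G : Prop :=
  weak_gradient Omega u G /\
  exists phi : nat -> V -> R, [/\ forall k, test_function Omega (phi k),
    L2_norm Omega (u \- phi k) @[k --> \oo] --> (0 : R) &
    L2v_norm Omega (fun i => G i \- partial i (phi k)) @[k --> \oo] --> (0 : R)].

Definition H10 Omega u : Prop := exists G, H10_gradient Omega u G.

(* A representative of the gradient of u in H^1_0(Omega); it is unique up to
   a.e. equality, and only ever used inside [L2v_inner].                      *)
Definition grad Omega u : 'I_d -> V -> R :=
  xget (fun _ _ => 0) [set G | H10_gradient Omega u G].

Definition dirichlet Omega u w : R :=
  L2v_inner Omega (grad Omega u) (grad Omega w).

Definition grad_norm Omega u : R := L2v_norm Omega (grad Omega u).

Definition H2_derivatives Omega u
    (D : ('I_d -> V -> R) * ('I_d -> 'I_d -> V -> R)) : Prop :=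
  weak_gradient Omega u D.1 /\
  forall i, weak_gradient Omega (D.1 i) (D.2 i).

Definition H2 Omega u : Prop := exists D, H2_derivatives Omega u D.

(* Independent of the representatives chosen for the weak derivatives. *)
Definition H2_norm Omega u : R :=
  let D := xget (fun _ _ => 0, fun _ _ _ => 0)
                [set D | H2_derivatives Omega u D] in
  Num.sqrt (L2_norm Omega u ^+ 2 + L2v_norm Omega D.1 ^+ 2 +
            \sum_i L2v_norm Omega (D.2 i) ^+ 2).

End sobolev.

Section finite_elements.
Context (R : realType) (d : nat).
Local Notation V := 'rV[R]_d.

(* A d-simplex is given by the matrix A whose d+1 rows are its vertices; its
   points are the products l *m A with l barycentric coordinates, and its face
   spanned by the vertices in J is obtained by restricting the support of l.  *)
Definition face (A : 'M[R]_(d.+1, d)) (J : pred 'I_d.+1) : set V :=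
  [set l *m A | l in [set l : 'rV[R]_d.+1 |
    [/\ forall i, 0 <= l 0 i, \sum_i l 0 i = 1 &
        forall i, l 0 i != 0 -> J i]]].

Definition simplex (A : 'M[R]_(d.+1, d)) : set V := face A predT.

Definition is_vertex (A : 'M[R]_(d.+1, d)) (x : V) : bool :=
  [exists i, row i A == x].

Definition diam (A : set V) : R :=
  sup [set r | exists x y, [/\ A x, A y & r = eucl_norm (x - y)]].

Definition covered (M : seq 'M[R]_(d.+1, d)) : set V :=
  [set x | exists2 A, A \in M & simplex A x].

Definition mesh_size (M : seq 'M[R]_(d.+1, d)) : R :=
  \big[Num.max/0]_(A <- M) diam (simplex A).

(* A conforming quasi-uniform triangulation M of mesh size h.  Since a domain
   with curved boundary is not a union of simplices, M is only required to
   exhaust Omega up to a boundary layer of width kappa * h^2 (when d = 1, or for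
   an exact partition, the layer is empty); finite element functions vanish on
   that layer.  [mesh_fat] contains the nondegeneracy of the simplices.       *)
Record quasi_uniform_mesh (Omega : set V) (rho kappa h : R)
    (M : seq 'M[R]_(d.+1, d)) : Prop := {
  mesh_sub : covered M `<=` closure Omega;
  mesh_conforming : forall A B, A \in M -> B \in M -> A <> B ->
    simplex A `&` simplex B = face A (fun i => is_vertex B (row i A)) /\
    exists i, ~~ is_vertex B (row i A);
  mesh_exhausts : forall x, Omega x -> ~ covered M x ->
    exists2 y, boundary Omega y & eucl_norm (x - y) <= kappa * h ^+ 2;
  mesh_has_size : mesh_size M = h;
  mesh_fat : forall A, A \in M ->
    exists c, [set x | eucl_norm (x - c) < rho * h] `<=` simplex A }.

(* Functions in H^1_0(Omega) that are continuous and affine on every simplex of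
   M; extended by 0 outside the triangulated region, so that equality in the
   space is equality of functions.                                            *)
Definition fe_space (Omega : set V) (M : seq 'M[R]_(d.+1, d)) :
    set (V -> R) :=
  [set chi | [/\ H10 Omega chi, continuous chi,
    forall A, A \in M -> exists (b : 'cV[R]_d) (c : R),
      forall x, simplex A x -> chi x = (x *m b) 0 0 + c &
    forall x, ~ covered M x -> chi x = 0]].

Definition elliptic_projection (Omega : set V) (S : set (V -> R))
    (P : (V -> R) -> V -> R) : Prop :=
  forall g, H10 Omega g ->
    S (P g) /\ forall chi, S chi -> dirichlet Omega (g \- P g) chi = 0.

Definition projection_estimate (Omega : set V) (h C : R)
    (P : (V -> R) -> V -> R) : Prop :=
  forall g, H2 Omega g -> H10 Omega g ->
    L2_norm Omega (g \- P g) + h * grad_norm Omega (g \- P g)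
      <= C * h ^+ 2 * H2_norm Omega g.

End finite_elements.

Section scheme.
Context (R : realType) (d : nat).
Local Notation V := 'rV[R]_d.

Definition assumption_A (f : R -> R) : Prop :=
  (forall z, derivable f z 1) /\
  forall r, 0 < r -> exists2 L, 0 < L &
    forall z1 z2, - r <= z1 <= r -> - r <= z2 <= r ->
      `|f z1 - f z2| + `|derive1 f z1 - derive1 f z2| <= L * `|z1 - z2|.

Definition u_step (Omega : set V) (S : set (V -> R)) (beta tau : R)
    (f : R -> R) (uold vold u : V -> R) : Prop :=
  S u /\ forall chi, S chi ->
    beta^-1 * L2_inner Omega (fun x => (u x - uold x) / tau) chi
      + dirichlet Omega u chi
      - 2 * L2_inner Omega vold chi * dirichlet Omega vold u
    = L2_inner Omega (f \o uold) chi
      - 2 * L2_inner Omega vold chi * L2_inner Omega (f \o uold) vold.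

Definition v_step (Omega : set V) (S : set (V -> R)) (gamma tau : R)
    (f : R -> R) (uold vold vstar : V -> R) : Prop :=
  S vstar /\ forall chi, S chi ->
    gamma^-1 * L2_inner Omega (fun x => (vstar x - vold x) / tau) chi
      + dirichlet Omega vstar chi
      - L2_inner Omega vold chi * dirichlet Omega vold vstar
    = L2_inner Omega (fun x => derive1 f (uold x) * vold x) chi
      - L2_inner Omega vold chi
        * L2_inner Omega (fun x => derive1 f (uold x) * vold x) vold.

(* w = z / ||z||, the division being meaningful. *)
Definition normalized (Omega : set V) (z w : V -> R) : Prop :=
  L2_norm Omega z != 0 /\ w = (fun x => z x / L2_norm Omega z).

(* (u, vs, v) solves the fully-discrete scheme up to time level m; [vs n] is
   v_h^{*,n}.  The values [u n], [v n] for n > m, and [vs n] for n = 0 or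
   n > m, are irrelevant.                                                     *)
Definition scheme_solution (Omega : set V) (S : set (V -> R))
    (P : (V -> R) -> V -> R) (beta gamma tau : R) (f : R -> R)
    (u0 v0 : V -> R) (m : nat) (u vs v : nat -> V -> R) : Prop :=
  [/\ u 0%N = P u0,
      normalized Omega (P v0) (v 0%N) &
      forall n, (n < m)%N ->
        [/\ u_step Omega S beta tau f (u n) (v n) (u n.+1),
            v_step Omega S gamma tau f (u n) (v n) (vs n.+1),
            S (v n.+1) &
            normalized Omega (vs n.+1) (v n.+1)]].

(* The family of spaces S h and projections P h is given for 0 < h < hbar. *)
Definition assumption_C (Omega : set V) (hbar : R) (S : R -> set (V -> R))
    (P : R -> (V -> R) -> V -> R) (beta gamma T : R) (f : R -> R)
    (u0 v0 : V -> R) (h0 tau0 C1 : R) : Prop :=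
  forall h (N : nat), 0 < h < h0 -> h < hbar -> (0 < N)%N -> T / N%:R < tau0 ->
    forall (m : nat) u vs v, (m <= N)%N ->
      scheme_solution Omega (S h) (P h) beta gamma (T / N%:R) f u0 v0 m u vs v ->
      forall n, (n <= m)%N -> (Linf_norm Omega (u n) <= C1%:E)%E.

End scheme.

(* Main.v *)
Require Import Defs.
From HB Require Import structures.
From mathcomp Require Import all_boot all_order all_algebra.
From mathcomp Require Import all_classical all_reals all_analysis.
From mathcomp Require Import measurable_realfun ess_sup_inf.
From mathcomp Require Import ring lra.

Set Implicit Arguments.
Unset Strict Implicit.
Unset Printing Implicit Defensive.

Import Order.TTheory GRing.Theory Num.Theory numFieldNormedType.Exports.

Local Open Scope classical_set_scope.
Local Open Scope ring_scope.

(** Both equations of the scheme are instances of one linear problem, a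
    semi-implicit heat step with a rank-one multiplier [k (a, chi) (Da, Du)],
    where [a] is the current normalised [v]: [k = 1] for [v], [k = 2] for [u].

    For [v], testing with [a] itself makes the multiplier terms cancel, so that
    the increment [v* - a] is orthogonal to [a]. Hence
    [|v*|^2 = 1 + |v* - a|^2 >= 1] ([increment_orth], [sqr_norm_step]), and
    normalisation does not increase the gradient. Testing with the increment
    then kills the multiplier once more and gives
    [|Dv*|^2 + |v* - a|^2 / (gamma tau) <= |Da|^2 + gamma tau |f'(u) a|^2]
    ([normalised_step_energy]). Summed over the steps, this bounds the gradients
    of [v] and [v*] by a constant [K], and [|v*|^2 - 1] by a multiple of [tau].

    For [u], testing with the increment leaves the multiplier term, which the
    Young inequality splits into a part absorbed on the left and a part
    [tau K^2 |Du|^2] ([energy_step]); a discrete Gronwall inequality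
    ([discrete_gronwall]) finishes the bound. The sources [f(u)] and [f'(u) v]
    are controlled in [L2] by the supremum bound on [u], which is available at
    every level up to which a solution has been constructed.

    The same Young inequality makes each linear problem definite once
    [tau K^2] is small ([step_form_def]). As finite element functions are
    determined by finitely many nodal values, definiteness yields existence as
    well as uniqueness ([lax_milgram]), and the solution is built one level at
    a time.

    The remaining work is to see that [L2_inner] and [dirichlet] are semi-inner
    products and that the former is definite on finite element functions. The
    first point rests on the fact that two [H10] gradients of one function
    differ by a null vector ([H10_gradient_null]), the second on the fact that
    nonempty open sets have positive measure ([box_measure], [open_ae]). *)

(** * Semi-inner products *)

(** The carrier [E] is a linear subspace of an ambient space [X] rather than a
    type of its own: [L2] and [H10] are predicates on functions, and functions
    that agree almost everywhere are not identified, so that definiteness has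
    to be left out as well. *)
Record semi_inner (R : rcfType) (X : lmodType R) (E : set X)
    (b : X -> X -> R) : Prop := {
  si_zero : E 0;
  si_comb : forall a x y, E x -> E y -> E (a *: x + y);
  si_lin : forall a x y z, E x -> E y -> E z ->
    b (a *: x + y) z = a * b x z + b y z;
  si_sym : forall x y, E x -> E y -> b x y = b y x;
  si_ge0 : forall x, E x -> 0 <= b x x }.

Section semi_inner.
Context (R : rcfType) (X : lmodType R) (E : set X) (b : X -> X -> R).
Hypothesis Eb : semi_inner E b.
Implicit Types (x y z : X) (a : R).
Local Notation nrm x := (Num.sqrt (b x x)).

Lemma si_scale a x : E x -> E (a *: x).
Proof. by move=> Ex; rewrite -[_ *: _]addr0; apply: (si_comb Eb) => //;
  exact: si_zero Eb. Qed.

Lemma si_add x y : E x -> E y -> E (x + y).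
Proof. by move=> Ex Ey; rewrite -[x]scale1r; exact: (si_comb Eb). Qed.

Lemma si_sub x y : E x -> E y -> E (x - y).
Proof. by move=> Ex Ey; rewrite addrC -scaleN1r; exact: (si_comb Eb). Qed.

Lemma si_add_l x y z : E x -> E y -> E z -> b (x + y) z = b x z + b y z.
Proof. by move=> Ex Ey Ez;
  rewrite -[in LHS](scale1r x) (si_lin Eb)// mul1r. Qed.

Lemma si_0l z : E z -> b 0 z = 0.
Proof.
move=> Ez; have := si_add_l (si_zero Eb) (si_zero Eb) Ez.
by rewrite addr0 => /eqP; rewrite -subr_eq0 opprD addNKr oppr_eq0 => /eqP.
Qed.

Lemma si_scale_l a x z : E x -> E z -> b (a *: x) z = a * b x z.
Proof.
move=> Ex Ez; rewrite -[_ *: _]addr0 (si_lin Eb) ?si_0l ?addr0//.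
exact: si_zero Eb.
Qed.

Lemma si_sub_l x y z : E x -> E y -> E z -> b (x - y) z = b x z - b y z.
Proof.
by move=> Ex Ey Ez; rewrite addrC -scaleN1r (si_lin Eb)// mulN1r addrC.
Qed.

Lemma si_scale_r a x z : E x -> E z -> b z (a *: x) = a * b z x.
Proof.
move=> Ex Ez; rewrite (si_sym Eb)//; last exact: si_scale.
by rewrite si_scale_l// (si_sym Eb (x:=x)).
Qed.

Lemma si_add_r x y z : E x -> E y -> E z -> b z (x + y) = b z x + b z y.
Proof.
move=> Ex Ey Ez; rewrite (si_sym Eb)//; last exact: si_add.
by rewrite si_add_l// (si_sym Eb (x:=x))// (si_sym Eb (x:=y)).
Qed.

Lemma si_sub_r x y z : E x -> E y -> E z -> b z (x - y) = b z x - b z y.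
Proof.
move=> Ex Ey Ez; rewrite (si_sym Eb)//; last exact: si_sub.
by rewrite si_sub_l// (si_sym Eb (x:=x))// (si_sym Eb (x:=y)).
Qed.

Lemma si_sub_sub x y : E x -> E y ->
  b (x - y) (x - y) = b x x - 2 * b x y + b y y.
Proof.
move=> Ex Ey; rewrite si_sub_l ?si_sub_r//; last exact: si_sub.
rewrite (si_sym Eb (x:=y) (y:=x))//; ring.
Qed.

Lemma sqr_nrm x : E x -> nrm x ^+ 2 = b x x.
Proof. by move=> Ex; rewrite sqr_sqrtr// (si_ge0 Eb). Qed.

(** This is what definiteness would give trivially: null vectors can be
    discarded inside the form. *)
Lemma si_null x y : E x -> E y -> b x x = 0 -> b x y = 0.
Proof.
move=> Ex Ey x0; have [->//|xy0] := eqVneq (b x y) 0.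
(* with this [t] the vector [y - t *: x] would have square norm -1 *)
pose t := (b y y + 1) / (2 * b x y).
have := si_ge0 Eb (si_sub Ey (si_scale t Ex)).
rewrite si_sub_sub//; last exact: si_scale.
rewrite !si_scale_l ?si_scale_r ?si_scale//; last exact: si_scale.
rewrite x0 (si_sym Eb (x:=y))// !mulr0 addr0 /t.
rewrite (_ : 2 * _ = b y y + 1); last by field; rewrite xy0.
by rewrite opprD addrA subrr add0r lerNr oppr0 ler10.
Qed.

Lemma cauchy_schwarz x y : E x -> E y -> `|b x y| <= nrm x * nrm y.
Proof.
move=> Ex Ey; rewrite -sqrtrM ?(si_ge0 Eb)// -sqrtr_sqr ler_wsqrtr//.
have [x0|x0] := eqVneq (b x x) 0.
  by rewrite si_null// expr0n/= mulr_ge0// (si_ge0 Eb).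
have xx : 0 < b x x by rewrite lt_def x0 (si_ge0 Eb).
have := si_ge0 Eb (si_sub Ey (si_scale (b x y / b x x) Ex)).
rewrite si_sub_sub//; last exact: si_scale.
rewrite !si_scale_l ?si_scale_r ?si_scale//; last exact: si_scale.
rewrite (si_sym Eb (x:=y))// -(ler_pM2l xx) mulr0.
rewrite (_ : _ * (_ + _) = b x x * b y y - b x y ^+ 2); last by field.
by rewrite subr_ge0.
Qed.

Lemma cauchy_schwarz_sqr x y : E x -> E y -> b x y ^+ 2 <= b x x * b y y.
Proof.
move=> Ex Ey;
  rewrite -(sqr_nrm Ex) -(sqr_nrm Ey) -exprMn -real_normK ?num_real//.
by rewrite lerXn2r ?nnegrE ?mulr_ge0 ?sqrtr_ge0 ?normr_ge0// cauchy_schwarz.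
Qed.

Lemma proj_contraction x y : E x -> E y -> b (x - y) y = 0 -> b y y <= b x x.
Proof.
move=> Ex Ey; rewrite si_sub_l// => /eqP; rewrite subr_eq0 => /eqP xy.
have := si_ge0 Eb (si_sub Ex Ey); rewrite si_sub_sub// xy; lra.
Qed.

Lemma nrm_triangle x y : E x -> E y -> nrm (x + y) <= nrm x + nrm y.
Proof.
move=> Ex Ey; rewrite -(@ler_pXn2r _ 2)// ?nnegrE ?addr_ge0 ?sqrtr_ge0//.
rewrite sqr_nrm; last exact: si_add.
rewrite si_add_l// ?si_add_r//; last exact: si_add.
rewrite sqrrD !sqr_nrm// (si_sym Eb (x:=y) (y:=x))//.
have := le_trans (ler_norm _) (cauchy_schwarz Ex Ey); rewrite -mulr_natl; lra.
Qed.

Lemma nrm_scale a x : E x -> nrm (a *: x) = `|a| * nrm x.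
Proof.
move=> Ex; rewrite si_scale_l ?si_scale_r ?si_scale//; last exact: si_scale.
by rewrite mulrA -expr2 sqrtrM ?sqr_ge0// sqrtr_sqr.
Qed.

End semi_inner.

(** * Coercive problems on finite-dimensional subspaces *)

Section lax_milgram.
Context (R : fieldType) (X : lmodType R) (S : set X).
Hypotheses (S0 : S 0) (SZ : forall a x y, S x -> S y -> S (a *: x + y)).

Lemma subspace_sum k (c : 'I_k -> R) (e : 'I_k -> X) :
  (forall i, S (e i)) -> S (\sum_i c i *: e i).
Proof.
move=> Se; elim/big_ind : _ => //[x y Sx Sy|i _].
  by rewrite -[x]scale1r; exact: SZ.
by rewrite -[_ *: _]addr0; exact: SZ.
Qed.

Lemma linear_on0 (Y : lmodType R) (g : X -> Y) :
  (forall a x y, S x -> S y -> g (a *: x + y) = a *: g x + g y) -> g 0 = 0.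
Proof.
move=> gl; have := gl 1 _ _ S0 S0; rewrite !scale1r addr0 => /eqP.
by rewrite -subr_eq0 opprD addNKr oppr_eq0 => /eqP.
Qed.

Lemma linear_on_sum (Y : lmodType R) (g : X -> Y) k (c : 'I_k -> R)
    (e : 'I_k -> X) :
  (forall a x y, S x -> S y -> g (a *: x + y) = a *: g x + g y) ->
  (forall i, S (e i)) -> g (\sum_i c i *: e i) = \sum_i c i *: g (e i).
Proof.
move=> gl Se; have g0 := linear_on0 gl.
have [] // : S (\sum_i c i *: e i) /\
  g (\sum_i c i *: e i) = \sum_i c i *: g (e i).
elim/big_ind2 : _ => //[x' x y' y [Sx <-] [Sy <-]|i _]; last first.
  split; first by rewrite -[_ *: _]addr0; exact: SZ.
  by rewrite -[in LHS](addr0 (c i *: e i)) gl// g0 addr0.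
split; first by rewrite -[x]scale1r; exact: SZ.
by rewrite -[in LHS](scale1r x) gl// scale1r.
Qed.

Context (n : nat) (ev : X -> 'rV[R]_n).
Hypotheses (evlin : forall a x y, S x -> S y ->
  ev (a *: x + y) = a *: ev x + ev y)
  (evinj : forall x, S x -> ev x = 0 -> x = 0).

Lemma ev_sum k (c : 'rV[R]_k) (e : 'I_k -> X) : (forall i, S (e i)) ->
  ev (\sum_i c 0 i *: e i) = c *m \matrix_i ev (e i).
Proof.
move=> Se.
rewrite linear_on_sum// mulmx_sum_row.
by apply: eq_bigr => i _; rewrite rowK.
Qed.

(** A family in [S] whose coordinate vectors are independent and as numerous
    as possible is a basis of [S]. *)
Lemma subspace_basis : exists k (e : 'I_k -> X), [/\ forall i, S (e i),
  row_free (\matrix_i ev (e i)) &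
  forall x, S x -> exists c : 'rV[R]_k, x = \sum_i c 0 i *: e i].
Proof.
pose Q k := exists e : 'I_k -> X,
  (forall i, S (e i)) /\ row_free (\matrix_i ev (e i)).
have Q0 : Q 0%N.
  exists (fun=> 0); split; first by case.
  by rewrite /row_free flatmx0 mxrank0.
have Qn k : Q k -> (k <= n)%N.
  by move=> [e [_ /eqP <-]]; exact: rank_leq_col.
have exQ : exists k, `[< Q k >] by exists 0%N; exact/asboolP.
have bQ k : `[< Q k >] -> (k <= n)%N by move/asboolP; exact: Qn.
case: (ex_maxnP exQ bQ) => k /asboolP[e [Se ef]] kmax.
exists k, e; split=> // x Sx.
pose M := \matrix_i ev (e i).
have xM : (ev x <= M)%MS.
  apply: contrapT => /negP xM.
  suff : Q (1 + k)%N by move/asboolP/kmax; rewrite add1n ltnn.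
  pose e' (i : 'I_(1 + k)) :=
    match fintype.split i with inl _ => x | inr j => e j end.
  exists e'; split; first by move=> i; rewrite /e'; case: fintype.split.
  have -> : \matrix_i ev (e' i) = col_mx (ev x) M.
    apply/row_matrixP => i; rewrite rowK /e'; case: splitP => j ij.
      have -> : i = lshift k j by exact: val_inj.
      by rewrite rowKu row_id.
    have -> : i = rshift 1 j by exact: val_inj.
    by rewrite rowKd rowK.
  apply: inj_row_free => v; rewrite -[v]hsubmxK mul_row_col => vM.
  have [v0|v0] := eqVneq (lsubmx v 0 0) 0.
    have l0 : lsubmx v = 0 by apply/rowP => i; rewrite ord1 v0 mxE.
    move: vM; rewrite l0 mul0mx add0r => /eqP.
    by rewrite (mulmx_free_eq0 _ ef) => /eqP ->; rewrite row_mx0.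
  move/eqP: vM; rewrite addr_eq0 [lsubmx v]mx11_scalar mul_scalar_mx => /eqP vM.
  case/negP: xM; apply/submxP; exists (- (lsubmx v 0 0)^-1 *: rsubmx v).
  by rewrite -scalemxAl scaleNr -scalerN -vM scalerA mulVf// scale1r.
have [c xc] := submxP xM; exists c.
apply/eqP; rewrite -subr_eq0; apply/eqP/evinj.
  by rewrite addrC -scaleN1r; apply: SZ => //; exact: subspace_sum.
rewrite addrC -scaleN1r evlin//; last exact: subspace_sum.
by rewrite ev_sum// scaleN1r -xc addNr.
Qed.

(** Existence follows from uniqueness: in a basis of [S] the problem is a
    square linear system, and definiteness of [B] makes its kernel trivial. *)
Lemma lax_milgram (B : X -> X -> R) (l : X -> R) :
  (forall a x y z, S x -> S y -> S z -> B (a *: x + y) z = a * B x z + B y z) ->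
  (forall a x y z, S x -> S y -> S z -> B z (a *: x + y) = a * B z x + B z y) ->
  (forall a x y, S x -> S y -> l (a *: x + y) = a * l x + l y) ->
  (forall x, S x -> B x x = 0 -> x = 0) ->
  exists2 u, S u & forall x, S x -> B u x = l x.
Proof.
move=> Bl Br ll Bdef; have [k [e [Se ef eS]]] := subspace_basis.
pose A := \matrix_(i, j) B (e i) (e j).
have BE (c : 'rV_k) j : B (\sum_i c 0 i *: e i) (e j) = (c *m A) 0 j.
  rewrite (@linear_on_sum R^o (B^~ (e j)))//; last by move=> *; exact: Bl.
  by rewrite mxE; apply: eq_bigr => i _; rewrite mxE.
have Aunit : A \in unitmx.
  rewrite -row_free_unit; apply: inj_row_free => c cA.
  have Sc : S (\sum_i c 0 i *: e i) by exact: subspace_sum.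
  have : \sum_i c 0 i *: e i = 0.
    apply: Bdef => //; rewrite (@linear_on_sum R^o (B _))//; last by move=> *;
      exact: Br.
    by apply: big1 => j _; rewrite BE cA mxE scaler0.
  move/(congr1 ev); rewrite ev_sum// (linear_on0 evlin) => /eqP.
  by rewrite (mulmx_free_eq0 _ ef) => /eqP.
pose c := \row_j l (e j) *m invmx A.
have Sc : S (\sum_i c 0 i *: e i) by exact: subspace_sum.
exists (\sum_i c 0 i *: e i) => // x /eS[y ->].
rewrite (@linear_on_sum R^o (B _))//; last by move=> *; exact: Br.
rewrite (@linear_on_sum R^o l)//; apply: eq_bigr => j _.
by rewrite BE mulmxKV// mxE.
Qed.

End lax_milgram.

(** * One step of the linearised scheme *)

(** The Young inequality, with a squared premise so that it combines with
    [cauchy_schwarz_sqr] without extracting square roots. *)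
Lemma le_add_of_sqr_le (R : realFieldType) (x y z : R) : 0 <= y -> 0 <= z ->
  x ^+ 2 <= 4 * (y * z) -> x <= y + z.
Proof.
move=> y0 z0 xyz; apply: le_trans (ler_norm _) _.
rewrite -(@ler_pXn2r _ 2)// ?nnegrE ?addr_ge0// real_normK ?num_real//.
apply: le_trans xyz _; have := sqr_ge0 (y - z); nra.
Qed.

Section linear_step.
Context (R : rcfType) (X : lmodType R).
Context (E : set X) (ip : X -> X -> R) (H : set X) (dir : X -> X -> R)
  (S : set X).
Hypotheses (Eip : semi_inner E ip) (Hdir : semi_inner H dir).
Hypotheses (S0 : S 0) (SZ : forall a x y, S x -> S y -> S (a *: x + y)).
Hypotheses (SE : S `<=` E) (SH : S `<=` H).

(** The equations for [u] and [v] are the instances [k = 2] and [k = 1] of one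
    linear problem: [a] is the current normalised vector, [z] the old value of
    the unknown and [g] the explicit source. *)
Definition linear_step (alpha k tau : R) (z a g u : X) : Prop :=
  S u /\ forall chi, S chi ->
    alpha^-1 * ip (tau^-1 *: (u - z)) chi + dir u chi
      - k * ip a chi * dir a u
    = ip g chi - k * ip a chi * ip g a.

Context (alpha k tau K2 : R) (a : X).
Hypotheses (alpha0 : 0 < alpha) (tau0 : 0 < tau) (k0 : 0 <= k <= 2).
Hypotheses (Sa : S a) (a1 : ip a a = 1) (aK : dir a a <= K2).

Definition step_form (u chi : X) : R :=
  (alpha * tau)^-1 * ip u chi + dir u chi - k * ip a chi * dir a u.

Lemma step_form_linl c x y z : S x -> S y -> S z ->
  step_form (c *: x + y) z = c * step_form x z + step_form y z.
Proof.
move=> Sx Sy Sz; rewrite /step_form.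
rewrite (si_lin Eip)//; [|exact: SE..].
rewrite (si_lin Hdir)//; [|exact: SH..].
rewrite (si_add_r Hdir) ?(si_scale_r Hdir)//; try exact: SH.
  by ring.
by apply: (si_scale Hdir); exact: SH.
Qed.

Lemma step_form_linr c x y z : S x -> S y -> S z ->
  step_form z (c *: x + y) = c * step_form z x + step_form z y.
Proof.
move=> Sx Sy Sz; rewrite /step_form.
rewrite !(si_add_r Eip) ?(si_scale_r Eip)//; try exact: SE.
- rewrite (si_add_r Hdir) ?(si_scale_r Hdir)//; try exact: SH.
    by ring.
  by apply: (si_scale Hdir); exact: SH.
- by apply: (si_scale Eip); exact: SE.
- by apply: (si_scale Eip); exact: SE.
Qed.

(** The negative term is at most [2 |w| K |Dw| <= K^2 |w|^2 + |Dw|^2], so it is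
    absorbed as soon as the time step is small compared with [K^-2]. *)
Lemma step_form_def w : alpha * tau * K2 < 1 -> S w -> step_form w w = 0 ->
  ip w w = 0.
Proof.
move=> small Sw; rewrite /step_form => w0.
have [Ea Ew Ha Hw] := And4 (SE Sa) (SE Sw) (SH Sa) (SH Sw).
have P0 := si_ge0 Eip Ew; have D0 := si_ge0 Hdir Hw.
have K0 : 0 <= K2 by apply: le_trans aK; exact: (si_ge0 Hdir).
have at0 : 0 < alpha * tau by exact: mulr_gt0.
have s2 := cauchy_schwarz_sqr Eip Ea Ew; rewrite a1 mul1r in s2.
have t2 : dir a w ^+ 2 <= K2 * dir w w.
  by apply: le_trans (cauchy_schwarz_sqr Hdir Ha Hw) _; exact: ler_wpM2r.
have kst : k * ip a w * dir a w <= K2 * ip w w + dir w w.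
  apply: le_add_of_sqr_le; rewrite ?mulr_ge0//.
  have k4 : k ^+ 2 <= 4 by case/andP: k0 => ? ?; nra.
  have st : ip a w ^+ 2 * dir a w ^+ 2 <= ip w w * (K2 * dir w w).
    by apply: ler_pM; rewrite ?sqr_ge0//.
  rewrite !exprMn -mulrA (_ : K2 * _ * _ = ip w w * (K2 * dir w w)).
    by apply: ler_pM => //; [exact: sqr_ge0|apply: mulr_ge0; exact: sqr_ge0].
  by ring.
apply/eqP; rewrite eq_le P0 andbT leNgt; apply/negP => Pp.
have : (alpha * tau)^-1 * ip w w <= K2 * ip w w by lra.
rewrite ler_pM2r// -(ler_pM2l at0) mulfV ?gt_eqF//; lra.
Qed.

Lemma linear_stepE z g u : S z -> E g ->
  linear_step alpha k tau z a g u <->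
  S u /\ forall chi, S chi -> step_form u chi =
    (alpha * tau)^-1 * ip z chi + ip g chi - k * ip a chi * ip g a.
Proof.
move=> Sz Eg.
suff eqv chi : S u -> S chi -> alpha^-1 * ip (tau^-1 *: (u - z)) chi =
    (alpha * tau)^-1 * ip u chi - (alpha * tau)^-1 * ip z chi.
  by split=> -[Su uE]; split=> // chi Sc; have := uE chi Sc;
    rewrite eqv// /step_form; lra.
move=> Su Sc; rewrite (si_scale_l Eip); [|apply: (si_sub Eip)|]; try exact: SE.
rewrite (si_sub_l Eip); try exact: SE.
by rewrite invfM; ring.
Qed.

Section well_posed.
Hypothesis small : alpha * tau * K2 < 1.
Hypothesis ipdef : forall w, S w -> ip w w = 0 -> w = 0.

Lemma linear_step_unique z g u u' : S z -> E g ->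
  linear_step alpha k tau z a g u -> linear_step alpha k tau z a g u' -> u = u'.
Proof.
move=> Sz Eg /(linear_stepE _ Sz Eg)[Su uE] /(linear_stepE _ Sz Eg)[Su' uE'].
have Sd : S (u - u') by rewrite addrC -scaleN1r; exact: SZ.
apply/eqP; rewrite -subr_eq0; apply/eqP; apply: ipdef => //.
apply: step_form_def => //.
have := step_form_linl (-1) Su' Su Sd.
by rewrite scaleN1r addrC uE// uE'// mulN1r addNr.
Qed.

Lemma linear_step_exists n (ev : X -> 'rV[R]_n) z g :
  (forall c x y, S x -> S y -> ev (c *: x + y) = c *: ev x + ev y) ->
  (forall x, S x -> ev x = 0 -> x = 0) ->
  S z -> E g -> exists u, linear_step alpha k tau z a g u.
Proof.
move=> evl evi Sz Eg.
pose l chi := (alpha * tau)^-1 * ip z chi + ip g chi - k * ip a chi * ip g a.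
have [||u Su uE] := lax_milgram S0 SZ evl evi (B := step_form) (l := l)
  step_form_linl step_form_linr.
- move=> c x y Sx Sy; rewrite /l.
  rewrite !(si_add_r Eip) ?(si_scale_r Eip)//; try exact: SE.
  all: try by apply: (si_scale Eip); exact: SE.
  by ring.
- by move=> x Sx x0; apply: ipdef => //; exact: step_form_def.
- by exists u; apply/linear_stepE.
Qed.

End well_posed.

End linear_step.

Section energy.
Context (R : rcfType) (X : lmodType R).
Context (E : set X) (ip : X -> X -> R) (H : set X) (dir : X -> X -> R)
  (S : set X).
Hypotheses (Eip : semi_inner E ip) (Hdir : semi_inner H dir).
Hypotheses (SZ : forall a x y, S x -> S y -> S (a *: x + y)).
Hypotheses (SE : S `<=` E) (SH : S `<=` H).
Context (alpha tau : R) (a : X).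
Hypotheses (alpha0 : 0 < alpha) (tau0 : 0 < tau).
Hypotheses (Sa : S a) (a1 : ip a a = 1).

Let S_sub x y : S x -> S y -> S (x - y).
Proof. by move=> Sx Sy; rewrite addrC -scaleN1r; exact: SZ. Qed.

Lemma dir_increment u z : S u -> S z ->
  (dir u u - dir z z) / 2 <= dir u (u - z).
Proof.
move=> Su Sz; have := si_ge0 Hdir (SH (S_sub Su Sz)).
rewrite (si_sub_sub Hdir) ?(si_sub_r Hdir)//; try exact: SH.
lra.
Qed.

Lemma step_test_increment k z g u : S z ->
  linear_step ip dir S alpha k tau z a g u ->
  (alpha * tau)^-1 * ip (u - z) (u - z) + dir u (u - z) =
  ip g (u - z) + k * ip a (u - z) * (dir a u - ip g a).
Proof.
move=> Sz [Su /(_ _ (S_sub Su Sz))].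
rewrite (si_scale_l Eip); try by apply: SE; exact: S_sub.
rewrite mulrA -invfM; lra.
Qed.

Section normalised_step.
Context (g w : X).
Hypotheses (Eg : E g) (aw : linear_step ip dir S alpha 1 tau a a g w).

(** Testing with [a] itself: the multiplier terms cancel exactly, so the
    increment is orthogonal to the sphere at [a]. *)
Lemma increment_orth : ip a (w - a) = 0.
Proof.
have [Sw /(_ _ Sa)] := aw; rewrite a1 (si_sym Hdir (x:=a)); try exact: SH.
rewrite (si_scale_l Eip); try by apply: SE; try exact: S_sub.
rewrite (si_sym Eip (y:=a)); try by apply: SE; try exact: S_sub.
rewrite !mulr1 !mul1r subrr => /eqP.
rewrite addrK mulrA mulf_eq0 mulf_eq0 !invr_eq0 (gt_eqF alpha0) (gt_eqF tau0).
by move=> /= /eqP.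
Qed.

Lemma sqr_norm_step : ip w w = 1 + ip (w - a) (w - a).
Proof.
have [Sw _] := aw; have := increment_orth.
rewrite (si_sub_r Eip) ?(si_sub_sub Eip)//; try exact: SE.
rewrite a1 (si_sym Eip (x:=a)); try exact: SE.
lra.
Qed.

Lemma normalised_step_energy :
  dir w w + (alpha * tau)^-1 * ip (w - a) (w - a)
    <= dir a a + alpha * tau * ip g g.
Proof.
have [Sw _] := aw; have := step_test_increment Sa aw.
rewrite increment_orth mulr0 mul0r addr0 => eqn.
have Ed := SE (S_sub Sw Sa).
have at0 : 0 < alpha * tau by exact: mulr_gt0.
have := dir_increment Sw Sa.
suff : 2 * ip g (w - a) <=
    (alpha * tau)^-1 * ip (w - a) (w - a) + alpha * tau * ip g g by lra.
have d0 := si_ge0 Eip Ed; have g0 := si_ge0 Eip Eg.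
move: (alpha * tau) at0 => c c0.
apply: le_add_of_sqr_le; rewrite ?mulr_ge0 ?invr_ge0 ?(ltW c0)//.
rewrite mulrACA mulVf ?gt_eqF// mul1r exprMn.
by have := cauchy_schwarz_sqr Eip Eg Ed; nra.
Qed.

End normalised_step.

(** Weighted Young inequalities move the increment to the left; what remains of
    the multiplier is [K^2 |Du|^2] times the step, as Gronwall needs. *)
Lemma energy_step (K2 F : R) z g u : S z -> E g -> dir a a <= K2 ->
  ip g g <= F -> linear_step ip dir S alpha 2 tau z a g u ->
  (1 - 4 * (alpha * tau) * K2) * dir u u
    <= dir z z + 10 * (alpha * tau) * F.
Proof.
move=> Sz Eg aK gF zu; have [Su _] := zu.
have := step_test_increment Sz zu; have := dir_increment Su Sz.
have Sd := S_sub Su Sz; have Ed := SE Sd; have Ea := SE Sa.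
have Ha := SH Sa; have Hu := SH Su.
have d0 := si_ge0 Eip Ed; have g0 := si_ge0 Eip Eg.
have u0 := si_ge0 Hdir Hu.
have K0 : 0 <= K2 by apply: le_trans aK; exact: (si_ge0 Hdir).
have F0 : 0 <= F by exact: le_trans gF.
have s2 := cauchy_schwarz_sqr Eip Ea Ed; rewrite a1 mul1r in s2.
have t2 : dir a u ^+ 2 <= K2 * dir u u.
  by apply: le_trans (cauchy_schwarz_sqr Hdir Ha Hu) _; exact: ler_wpM2r.
have r2 : ip g a ^+ 2 <= F.
  by apply: le_trans (cauchy_schwarz_sqr Eip Eg Ea) _; rewrite a1 mulr1.
have q2 : ip g (u - z) ^+ 2 <= F * ip (u - z) (u - z).
  by apply: le_trans (cauchy_schwarz_sqr Eip Eg Ed) _; exact: ler_wpM2r.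
have : 0 < alpha * tau by exact: mulr_gt0.
move: (alpha * tau) => c c0.
move: (ip (u - z) (u - z)) (ip a (u - z)) (ip g (u - z)) (ip g a) (dir a u)
  (dir u u) (dir z z) (dir u (u - z)) d0 u0 s2 t2 r2 q2
  => P s q r t U Z W P0 U0 s2 t2 r2 q2 le_W eqn.
have ci : c * c^-1 = 1 by rewrite mulfV ?gt_eqF.
have ci0 : 0 < c^-1 by rewrite invr_gt0.
have cP : 0 <= c^-1 * P by exact: mulr_ge0 (ltW ci0) P0.
have KU : 0 <= K2 * U by exact: mulr_ge0.
have cKU : 0 <= c * (K2 * U) by exact: mulr_ge0 (ltW c0) KU.
have cF : 0 <= c * F by exact: mulr_ge0 (ltW c0) F0.
have st : s ^+ 2 * t ^+ 2 <= P * (K2 * U).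
  by apply: ler_pM => //; exact: sqr_ge0.
have sr : s ^+ 2 * r ^+ 2 <= P * F by apply: ler_pM => //; exact: sqr_ge0.
have l1 : 2 * s * t <= c^-1 * P / 2 + 2 * c * K2 * U.
  apply: le_add_of_sqr_le; [lra|lra|].
  rewrite (_ : 4 * _ = 4 * (P * (K2 * U))); last by field; rewrite gt_eqF.
  by rewrite !exprMn; lra.
have l2 : q <= c^-1 * P / 4 + c * F.
  apply: le_add_of_sqr_le; [lra|lra|].
  by rewrite (_ : 4 * _ = F * P)//; field; rewrite gt_eqF.
have l3 : - (2 * s * r) <= c^-1 * P / 4 + 4 * c * F.
  apply: le_add_of_sqr_le; [lra|lra|].
  rewrite (_ : 4 * (_ * (_ * F)) = 4 * (P * F)); last by field; rewrite gt_eqF.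
  by rewrite sqrrN !exprMn; lra.
lra.
Qed.

End energy.

(** The bound depends on [c] and [e] only through [N c] and [N e], which are
    independent of the step number when both are proportional to the step. *)
Lemma discrete_gronwall (R : realType) (c e : R) (N : nat) (y : nat -> R) :
  0 <= c -> 0 <= e -> 0 <= y 0%N ->
  (forall n, (n < N)%N -> y n.+1 <= (1 + c) * (y n + e)) ->
  forall n, (n <= N)%N -> y n <= expR (N%:R * c) * (y 0%N + N%:R * e).
Proof.
move=> c0 e0 y0 yS n nN.
have c1 : 1 <= 1 + c by lra.
have : y n <= (1 + c) ^+ n * (y 0%N + n%:R * e).
  elim: n nN => [|n IH] nN; first by rewrite expr0 mul1r mul0r addr0.
  apply: le_trans (yS _ nN) _;
    rewrite exprS -mulrA ler_wpM2l ?(le_trans ler01)//.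
  apply: (@le_trans _ _ ((1 + c) ^+ n * (y 0%N + n%:R * e) + (1 + c) ^+ n * e)).
    by apply: lerD; [exact: IH (ltnW nN)|rewrite ler_peMl ?exprn_ege1].
  by rewrite -mulrDr -addrA -{2}[e]mul1r -mulrDl natr1.
move/le_trans; apply; apply: ler_pM.
- by rewrite exprn_ge0// (le_trans ler01).
- by rewrite addr_ge0// mulr_ge0.
- apply: (@le_trans _ _ ((1 + c) ^+ N)); first exact: ler_weXn2l.
  rewrite expRM_natl; apply: lerXn2r; last exact: expR_ge1Dx.
    by rewrite nnegrE; lra.
  by rewrite nnegrE expR_ge0.
- by rewrite lerD2l ler_wpM2r// ler_nat.
Qed.

(** * Square-integrable functions *)

Section square_integrable.
Context (disp : measure_display) (T : measurableType disp) (R : realType)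
  (mu : {measure set T -> \bar R}) (D : set T).
Hypothesis mD : measurable D.
Implicit Types f g : T -> R.

Definition sqint f : Prop :=
  measurable_fun D f /\ mu.-integrable D (fun t => (f t ^+ 2)%:E).

Lemma sqint_prod f g : sqint f -> sqint g ->
  mu.-integrable D (EFin \o (fun t => f t * g t)).
Proof.
move=> [mf f2] [mg g2].
apply: (le_integrable mD _ _ (integrableD mD f2 g2)).
  by apply/measurable_EFinP; exact: measurable_funM.
move=> t _ /=; rewrite lee_fin.
rewrite [leRHS]ger0_norm ?addr_ge0 ?sqr_ge0// ler_norml.
have := sqr_ge0 (f t + g t); have := sqr_ge0 (f t - g t).
have := sqr_ge0 (f t); have := sqr_ge0 (g t).
by move=> ? ? ? ?; apply/andP; split; nra.
Qed.

Lemma sqint_comb (a : R) f g : sqint f -> sqint g -> sqint (a *: f + g).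
Proof.
move=> sf sg; have [mf f2] := sf; have [mg g2] := sg.
have mfg : measurable_fun D (a *: f + g).
  apply: measurable_funD => //; exact: (measurable_funM (measurable_cst a)).
split=> //.
have fg := sqint_prod sf sg.
have := integrableD mD (integrableD mD (integrableZl mD (a ^+ 2) f2) g2)
  (integrableZl mD (2 * a) fg).
apply: eq_integrable => // t _ /=.
rewrite -!EFinM -!EFinD; congr EFin.
by rewrite (_ : (a *: f + g) t = a * f t + g t)//; ring.
Qed.

Lemma sqint0 : sqint 0.
Proof.
split; first exact: measurable_cst.
apply: eq_integrable (integrable0 mu D) => // t _ /=.
by rewrite expr0n.
Qed.

Section bounded_factor.
Context (f g : T -> R) (C : R).
Hypotheses (C0 : 0 <= C) (mg : measurable_fun D g)
  (gC : {ae mu, forall t, D t -> `|g t| <= C}) (sf : sqint f).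

Let integral_sqr_mul :
  (\int[mu]_(t in D) ((g t * f t) ^+ 2)%:E
    <= (C ^+ 2)%:E * \int[mu]_(t in D) (f t ^+ 2)%:E)%E.
Proof.
have [mf f2] := sf.
have mgf : measurable_fun D (fun t => (g t * f t) ^+ 2).
  by apply: measurable_funX; exact: measurable_funM.
have mCf : measurable_fun D (fun t => C ^+ 2 * f t ^+ 2).
  by apply: measurable_funM => //; exact: measurable_funX.
have Cf0 t : 0 <= C ^+ 2 * f t ^+ 2 by rewrite mulr_ge0 ?sqr_ge0.
pose m t := Num.min ((g t * f t) ^+ 2) (C ^+ 2 * f t ^+ 2).
have mm : measurable_fun D m by exact: measurable_minr.
have m0 t : 0 <= m t by rewrite le_min sqr_ge0 Cf0.
rewrite -ge0_integralZl_EFin ?sqr_ge0//; last 2 first.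
- by move=> t _; rewrite lee_fin sqr_ge0.
- by have /integrableP[] := f2.
rewrite (@ge0_ae_eq_integral _ _ _ mu D _ (EFin \o m))//.
- apply: ge0_le_integral => //.
  + by move=> t _; rewrite lee_fin m0.
  + exact/measurable_EFinP.
  + exact/measurable_EFinP.
  + by move=> t _; rewrite lee_fin ge_min lexx orbT.
- exact/measurable_EFinP.
- exact/measurable_EFinP.
- by move=> t _; rewrite lee_fin sqr_ge0.
- by move=> t _; rewrite lee_fin m0.
apply: filterS gC => t gt /gt {}gt; congr EFin; rewrite /m min_l// exprMn.
rewrite ler_wpM2r ?sqr_ge0//.
by rewrite -real_normK ?num_real// lerXn2r ?nnegrE.
Qed.

Lemma sqint_mul_bounded : sqint (fun t => g t * f t).
Proof.
have [mf f2] := sf; have mgf := measurable_funM mg mf.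
split=> //; apply/integrableP; split.
  by apply/measurable_EFinP; exact: measurable_funX.
under eq_integral do rewrite gee0_abs ?lee_fin ?sqr_ge0//.
apply: le_lt_trans integral_sqr_mul _.
rewrite -(fineK (integrable_fin_num mD f2)) -EFinM; exact: ltry.
Qed.

Lemma ip_mul_bounded :
  \int[mu]_(t in D) (g t * f t * (g t * f t))
    <= C ^+ 2 * \int[mu]_(t in D) (f t * f t).
Proof.
have [_ f2] := sf; have [_ gf2] := sqint_mul_bounded.
have ffin := integrable_fin_num mD f2.
have gffin := integrable_fin_num mD gf2.
rewrite -lee_fin EFinM /Rintegral.
under eq_integral do rewrite -expr2.
under [X in (_ * (fine X)%:E)%E]eq_integral do rewrite -expr2.
by rewrite !fineK.
Qed.

End bounded_factor.

Lemma sqint_cst (c : R) : (mu D < +oo)%E -> sqint (fun=> c).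
Proof.
move=> Doo; split=> //; apply/integrableP; split=> //.
rewrite (integral_cst mu mD) lte_mul_pinfty//; exact: ltry.
Qed.

Lemma sqint_ip : semi_inner sqint (fun f g => \int[mu]_(t in D) (f t * g t)).
Proof.
split.
- exact: sqint0.
- exact: sqint_comb.
- move=> a f g h sf sg sh.
  have fh := sqint_prod sf sh; have gh := sqint_prod sg sh.
  rewrite -RintegralZl// -RintegralD//; last exact: (integrableZl mD a fh).
  by apply: eq_Rintegral => t _; rewrite mulrA -mulrDl.
- by move=> f g _ _; apply: eq_Rintegral => t _; exact: mulrC.
- by move=> f _; apply: Rintegral_ge0 => t _; rewrite -expr2 sqr_ge0.
Qed.

Lemma sqint_null f : sqint f -> \int[mu]_(t in D) (f t * f t) = 0 ->
  {ae mu, forall t, D t -> f t = 0}.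
Proof.
move=> sf f0; have [mf f2] := sf.
have mf2 : measurable_fun D (EFin \o (fun t => f t ^+ 2)).
  by apply/measurable_EFinP; exact: measurable_funX.
have : ae_eq mu D (EFin \o (fun t => f t ^+ 2)) (cst 0%E).
  apply/(ae_eq_integral_abs mu mD mf2).
  under eq_integral do rewrite gee0_abs ?lee_fin ?sqr_ge0//.
  move: f0; rewrite /Rintegral; under eq_integral do rewrite -expr2.
  by move=> f0; rewrite -[LHS]fineK ?f0//; exact: (integrable_fin_num mD f2).
apply: filterS => t ft /ft[/eqP]; rewrite sqrf_eq0 => /eqP//.
Qed.

End square_integrable.

(** * Boxes and open sets for Lebesgue measure on tuples *)

Section boxes.
Context (R : realType).

Definition box n (a : 'I_n -> R) (e : R) : set (n.-tuple (measurableTypeR R)) :=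
  [set t | forall i, `|a i - tnth t i| < e].

Lemma measurable_box n (a : 'I_n -> R) e : measurable (box a e).
Proof.
rewrite (_ : box a e = \bigcap_(i in [set: 'I_n])
  (fun t : n.-tuple (measurableTypeR R) => tnth t i) @^-1` ball (a i) e).
  apply: fin_bigcap_measurable => // i _.
  rewrite -[X in measurable X]setTI; apply: measurable_tnth => //.
  exact: measurable_ball.
by apply/seteqP; split=> t bt; [move=> i _; exact: bt|move=> i; exact: bt].
Qed.

Lemma box_measure n (a : 'I_n -> R) e : 0 < e ->
  (0 < lebesgue_tuple R n (box a e) < +oo)%E.
Proof.
move=> e0; elim: n a => [|n IH] a.
  by rewrite /= (_ : box a e = setT) ?diracT ?lte01 ?ltry//; apply/seteqP;
    split=> // t _ [].
rewrite /= /cons_measure /pushforward.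
rewrite (_ : _ @^-1` _ = ball (a ord0) e `*` box (fun i => a (lift ord0 i)) e).
  rewrite product_measure1E; [|exact: measurable_ball|exact: measurable_box].
  rewrite [X in (X * _)%E](lebesgue_measure_ball (a ord0) (ltW e0)).
  have /andP[m0 moo] := IH (fun i => a (lift ord0 i)).
  apply/andP; split; first by rewrite mule_gt0// lte_fin mulrn_wgt0.
  by rewrite lte_mul_pinfty// lee_fin mulrn_wge0// ltW.
apply/seteqP; split => -[x t]; rewrite /box /preimage /mkset /=.
  move=> xt; split=> [|i]; first by have := xt ord0; rewrite tnth0.
  by have := xt (lift ord0 i); rewrite tnthS.
case=> /= ax bt i; case: (unliftP ord0 i) => [j ->|->]; last by rewrite tnth0.
by rewrite tnthS; exact: bt.
Qed.

Context (d : nat).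
Local Notation V := 'rV[R]_d.
Local Notation leb := (lebesgue_tuple R d).

Lemma preimage_vec_ball (x : V) (e : R) : 0 < e ->
  @vec R d @^-1` ball x e = box (x 0) e.
Proof.
move=> e0; apply/seteqP; split=> t.
  by move=> [_ bt] i; have := bt 0 i; rewrite /vec mxE.
by move=> bt; split=> // i j; rewrite ord1 /vec mxE; exact: bt.
Qed.

(** An open set is the union of the countably many balls with rational centre
    and inverse integer radius that it contains. *)
Lemma measurable_open_vec (U : set V) : open U -> measurable (@vec R d @^-1` U).
Proof.
move=> oU.
pose c (p : {ffun 'I_d -> rat} * nat) : V := \row_i ratr (p.1 i).
pose r (p : {ffun 'I_d -> rat} * nat) : R := p.2.+1%:R^-1.
pose F p := if `[< ball (c p) (r p) `<=` U >]
  then @vec R d @^-1` ball (c p) (r p) else set0.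
rewrite (_ : _ @^-1` U = \bigcup_p F p).
  apply: countable_bigcupT_measurable; first exact: countableP.
  move=> p; rewrite /F; case: ifPn => // _.
  rewrite preimage_vec_ball//; last by rewrite /r invr_gt0.
  exact: measurable_box.
apply/seteqP; split=> t; last first.
  by move=> [p _]; rewrite /F; case: ifPn => // /asboolP; exact.
move=> Ut; have := open_nbhs_nbhs (conj oU Ut).
rewrite -nbhs_ballE => -[e /= e0 eU].
have [k ke] : exists k : nat, k.+1%:R^-1 + k.+1%:R^-1 < e.
  have [k _ ke] := near_infty_natSinv_lt (PosNum (divr_gt0 e0 (ltr0n R 2))).
  exists k; have := ke k (leqnn k); rewrite /=.
  by move: (k.+1%:R^-1) => x; lra.
have k0 : 0 < (k.+1%:R^-1 : R) by rewrite invr_gt0.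
have /choice[q qt] : forall i : 'I_d, exists q : rat,
    `|ratr q - tnth t i| < k.+1%:R^-1.
  move: (k.+1%:R^-1) k0 => s s0 i.
  have lt : (tnth t i : R) - s < (tnth t i : R) + s by lra.
  have [q] := rat_in_itvoo lt; rewrite in_itv/= => /andP[q1 q2].
  by exists q; rewrite ltr_norml; apply/andP; split; lra.
exists ([ffun i => q i], k) => //; rewrite /F.
have ct : ball (c ([ffun i => q i], k)) k.+1%:R^-1 (vec t).
  by split=> // i j; rewrite !mxE ffunE; exact: qt.
rewrite asboolT//= => y cy; apply: eU.
apply: (le_ball (ltW ke)); apply: ball_triangle cy.
exact: ball_sym.
Qed.

Lemma measurable_continuous_vec (D : set (d.-tuple (measurableTypeR R)))
    (u : V -> R) : continuous u -> measurable_fun D (u \o @vec R d).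
Proof.
move=> cu; apply: (@measurable_funTS _ _ _ _ D).
apply: (measurability _ (RGenOpens.measurableE R)) => _ [_ [p [q ->] <-]].
rewrite setTI comp_preimage; apply: measurable_open_vec.
by move/continuousP : cu; apply; exact: interval_open.
Qed.

Lemma open_ae (U : set V) (u : V -> R) : open U -> continuous u ->
  {ae leb, forall t, (@vec R d @^-1` U) t -> u (vec t) = 0} ->
    {in U, u =1 cst 0}.
Proof.
move=> oU cu [N [mN N0 uN]] x; rewrite inE => Ux.
apply/eqP/negP => /negP ux.
have oW : open (U `&` [set y | u y != 0]).
  apply: openI => //.
  rewrite (_ : [set y | u y != 0] = u @^-1` (~` [set 0])).
    by apply: open_comp => // *; exact: closed_openC (@closed_eq _ _).
  by apply/seteqP; split=> y /eqP.
have := open_nbhs_nbhs (conj oW (conj Ux ux)).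
rewrite -nbhs_ballE => -[e /= e0 eW].
have /andP[+ _] := box_measure (x 0) e0.
rewrite -preimage_vec_ball// ltNge => /negP; apply.
rewrite -N0; apply: le_measure; rewrite ?inE//.
  by rewrite preimage_vec_ball//; exact: measurable_box.
move=> t /eW[Ut ut]; apply: uN => /(_ Ut) ut0; by rewrite /mkset ut0 eqxx in ut.
Qed.

Lemma bounded_vec_finite (U : set V) : open U -> bounded_set U ->
  (leb (@vec R d @^-1` U) < +oo)%E.
Proof.
move=> oU [M [Mreal MU]].
have e0 : 0 < `|M| + 2 by have := normr_ge0 M; lra.
have /andP[_] := box_measure ((0 : V) 0) e0.
rewrite -preimage_vec_ball//; apply: le_lt_trans.
apply: le_measure; rewrite ?inE.
- exact: measurable_open_vec.
- by rewrite preimage_vec_ball//; exact: measurable_box.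
move=> t Ut; rewrite /preimage /mkset mx_norm_ball /ball_/= sub0r normrN.
have M1 : M < `|M| + 1 by have := ler_norm M; lra.
have := MU _ M1 _ Ut; rewrite /=; lra.
Qed.

End boxes.

(** * The spaces [L2] and [H10] *)

Section sobolev_spaces.
Context (R : realType) (d : nat) (Omega : set 'rV[R]_d).
Hypotheses (oOmega : open Omega) (bOmega : bounded_set Omega).
Local Notation V := 'rV[R]_d.
Local Notation leb := (lebesgue_tuple R d).
Local Notation D := (@vec R d @^-1` Omega).
Implicit Types (u w phi psi : V -> R) (G H : 'I_d -> V -> R).

Let mD : measurable D. Proof. exact: measurable_open_vec. Qed.

Lemma L2_semi_inner : semi_inner (L2 Omega) (L2_inner Omega).
Proof.
have S := sqint_ip leb mD; split.
- exact: (si_zero S).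
- by move=> a u w Lu Lw; exact: (si_comb S a Lu Lw).
- by move=> a u w z Lu Lw Lz; exact: (si_lin S a Lu Lw Lz).
- by move=> u w Lu Lw; exact: (si_sym S Lu Lw).
- by move=> u Lu; exact: (si_ge0 S Lu).
Qed.

Lemma L2v_semi_inner :
  semi_inner [set G | forall i, L2 Omega (G i)] (L2v_inner Omega).
Proof.
have S := L2_semi_inner; split.
- by move=> i; exact: (si_zero S).
- by move=> a G H LG LH i; exact: (si_comb S a (LG i) (LH i)).
- move=> a G H K LG LH LK; rewrite /L2v_inner mulr_sumr -big_split/=.
  by apply: eq_bigr => i _; exact: (si_lin S a (LG i) (LH i) (LK i)).
- move=> G H LG LH; apply: eq_bigr => i _; exact: (si_sym S (LG i) (LH i)).
- by move=> G LG; apply: sumr_ge0 => i _; exact: (si_ge0 S (LG i)).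
Qed.

Lemma partial_comb i (a : R) u w : (forall x, derivable u x (delta_mx 0 i)) ->
  (forall x, derivable w x (delta_mx 0 i)) ->
  partial i (a *: u + w) = a *: partial i u + partial i w.
Proof.
move=> du dw; apply/funext => x; rewrite /partial.
have dau : derivable (a *: u) x (delta_mx 0 i) by exact: derivableZ.
by rewrite deriveD// deriveZ.
Qed.

Lemma continuous_comb (a : R) u w : continuous u -> continuous w ->
  continuous (a *: u + w).
Proof.
move=> cu cw x.
have cau := @cvgMl_tmp _ _ _ (nbhs_filter x) _ a _ (cu x).
exact: (@cvgD _ _ _ _ (nbhs_filter x) _ _ _ _ cau (cw x)).
Qed.

Lemma Ck_comb k (a : R) u w : Ck k u -> Ck k w -> Ck k (a *: u + w).
Proof.
elim: k u w => [|k IH] u w [cu Cu] [cw Cw].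
  by split=> //; exact: continuous_comb.
split; first by exact: continuous_comb.
move=> i; have [du Cdu] := Cu i; have [dw Cdw] := Cw i; split.
  by move=> x; apply: derivableD; [exact: derivableZ|].
by rewrite partial_comb//; exact: IH.
Qed.

Lemma Ck0 k : Ck k (0 : V -> R).
Proof.
elim: k => [|k IH]; first by split=> //; exact: cst_continuous.
split; first exact: cst_continuous.
move=> i; split; first by move=> x; exact: derivable_cst.
rewrite (_ : partial i _ = 0)//; apply/funext => x.
exact: derive_cst.
Qed.

Lemma test_function0 : test_function Omega 0.
Proof.
split; first by move=> k; exact: Ck0.
by exists set0; split=> //; exact: compact0.
Qed.

Lemma test_function_comb (a : R) phi psi : test_function Omega phi ->
  test_function Omega psi -> test_function Omega (a *: phi + psi).
Proof.
move=> [sphi [K [cK KO K0]]] [spsi [L [cL LO L0]]]; split.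
  by move=> k; exact: Ck_comb.
exists (K `|` L); split; first exact: compactU.
  by rewrite subUset.
move=> x /not_orP[/K0 x0 /L0 x1].
by rewrite (_ : (a *: phi + psi) x = a * phi x + psi x)// x0 x1 mulr0 addr0.
Qed.

Lemma test_function_derivable i phi x : test_function Omega phi ->
  derivable phi x (delta_mx 0 i).
Proof. by move=> [/(_ 1%N)[_ /(_ i)[+ _]] _]; exact. Qed.

Lemma test_function_partial i phi : test_function Omega phi ->
  test_function Omega (partial i phi).
Proof.
move=> [sphi [K [cK KO K0]]]; split.
  by move=> k; have [_ /(_ i)[]] := sphi k.+1.
exists K; split=> // x Kx; rewrite /partial.
transitivity ('D_(delta_mx 0 i) (cst 0 : V -> R) x); last exact: derive_cst.
apply: near_eq_derive.
have : nbhs x (~` K).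
  apply: open_nbhs_nbhs; split=> //; apply: closed_openC.
  exact: compact_closed.
by apply: filterS => y /K0.
Qed.

Lemma test_function_L2 phi : test_function Omega phi -> L2 Omega phi.
Proof.
move=> [sphi [K [cK KO K0]]]; have [cphi _] := sphi 0%N.
have [M [Mreal MK]] :=
  compact_bounded (continuous_compact (continuous_subspaceT cphi) cK).
have M1 : M < `|M| + 1 by have := ler_norm M; lra.
have b x : `|phi x| <= `|M| + 1.
  have [Kx|Kx] := pselect (K x); first by apply: (MK _ M1); exists x.
  by rewrite K0// normr0; have := normr_ge0 M; lra.
have C0 : 0 <= `|M| + 1 by have := normr_ge0 M; lra.
have phib : {ae leb, forall t, D t -> `|(phi \o @vec R d) t| <= `|M| + 1}.
  by apply: aeW => t _; exact: b.
have := sqint_mul_bounded mD C0 (measurable_continuous_vec cphi) phib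
  (sqint_cst mD 1 (bounded_vec_finite oOmega bOmega)).
by under [X in sqint _ _ X]eq_fun do rewrite mulr1.
Qed.

Lemma H10_gradient0 : H10_gradient Omega 0 0.
Proof.
have S := L2_semi_inner; have Sv := L2v_semi_inner.
have d0 i : partial i (0 : V -> R) = 0 by apply/funext => x; exact: derive_cst.
have t0 := test_function0; split.
  split; first exact: (si_zero S).
  move=> i; split; first exact: (si_zero S).
  move=> chi tchi; rewrite !(si_0l S) ?oppr0//; first exact: test_function_L2.
  exact: test_function_L2 (test_function_partial i tchi).
exists (fun=> 0); split=> //.
  rewrite (_ : 0 \- 0 = 0 :> (V -> R)); last by rewrite -[RHS](subrr 0).
  by rewrite /L2_norm (si_0l S) ?sqrtr0; [exact: cvg_cst|exact: (si_zero S)].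
rewrite (_ : (fun k => _) = cst 0); first exact: cvg_cst.
apply/funext => k /=; rewrite (_ : (fun i => _) = 0).
  by rewrite /L2v_norm (si_0l Sv) ?sqrtr0//; exact: (si_zero Sv).
by apply/funext => i; rewrite d0 -[RHS](subrr 0).
Qed.

Lemma cvg0_le (f g : nat -> R) : (forall k, 0 <= f k <= g k) ->
  g k @[k --> \oo] --> (0 : R) -> f k @[k --> \oo] --> (0 : R).
Proof.
move=> fg g0; apply: (squeeze_cvgr _ (cvg_cst 0) g0).
by apply: nearW => k; exact: fg.
Qed.

Lemma H10_gradient_comb (a : R) u w G H : H10_gradient Omega u G ->
  H10_gradient Omega w H -> H10_gradient Omega (a *: u + w) (a *: G + H).
Proof.
have S := L2_semi_inner; have Sv := L2v_semi_inner.
move=> [[Lu wG] [phi [tphi uphi Gphi]]] [[Lw wH] [psi [tpsi wpsi Hpsi]]].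
have LG i : L2 Omega (G i) by have [] := wG i.
have LH i : L2 Omega (H i) by have [] := wH i.
split.
  split; first exact: (si_comb S).
  move=> i; split; first exact: (si_comb S).
  move=> chi tchi.
  have Ld := test_function_L2 (test_function_partial i tchi).
  have Lc := test_function_L2 tchi.
  rewrite (si_lin S)// (wG i).2// (wH i).2//.
  by rewrite (_ : (a *: G + H) i = a *: G i + H i)// (si_lin S)//; ring.
exists (fun k => a *: phi k + psi k); split.
- by move=> k; exact: test_function_comb.
- have bnd : `|a| * L2_norm Omega (u \- phi k) + L2_norm Omega (w \- psi k)
      @[k --> \oo] --> (0 : R).
    rewrite -[X in _ --> X](addr0 0) -[X in X + _](mulr0 `|a|).
    exact: (cvgD (@cvgMl_tmp _ _ _ _ _ `|a| _ uphi) wpsi).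
  apply: cvg0_le bnd => k; rewrite sqrtr_ge0/=.
  have L1 := si_sub S Lu (test_function_L2 (tphi k)).
  have L2' := si_sub S Lw (test_function_L2 (tpsi k)).
  rewrite /L2_norm -(nrm_scale S a L1).
  rewrite (_ : _ \- _ = a *: (u - phi k) + (w - psi k)); last first.
    by rewrite scalerBr addrACA -opprD.
  exact: (nrm_triangle S (si_scale S a L1) L2').
- have bnd : `|a| * L2v_norm Omega (fun i => G i \- partial i (phi k)) +
      L2v_norm Omega (fun i => H i \- partial i (psi k))
      @[k --> \oo] --> (0 : R).
    rewrite -[X in _ --> X](addr0 0) -[X in X + _](mulr0 `|a|).
    exact: (cvgD (@cvgMl_tmp _ _ _ _ _ `|a| _ Gphi) Hpsi).
  apply: cvg0_le bnd => k; rewrite sqrtr_ge0/=.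
  pose dphi : 'I_d -> V -> R := fun i => partial i (phi k).
  pose dpsi : 'I_d -> V -> R := fun i => partial i (psi k).
  have L1 := si_sub Sv LG
    (fun i => test_function_L2 (test_function_partial i (tphi k)) :
      L2 _ (dphi i)).
  have L2' := si_sub Sv LH
    (fun i => test_function_L2 (test_function_partial i (tpsi k)) :
      L2 _ (dpsi i)).
  rewrite /L2v_norm -(nrm_scale Sv a L1).
  rewrite (_ : (fun i => _ \- _) = a *: (G - dphi) + (H - dpsi)); last first.
    apply/funext => i; rewrite partial_comb.
    - rewrite (_ : (a *: (G - dphi) + (H - dpsi)) i =
        a *: (G i - partial i (phi k)) + (H i - partial i (psi k)))//.
      by rewrite scalerBr addrACA -opprD.
    - by move=> x; exact: test_function_derivable (tphi k).
    - by move=> x; exact: test_function_derivable (tpsi k).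
  exact: (nrm_triangle Sv (si_scale Sv a L1) L2').
Qed.

(** The derivatives of the approximating test functions are test functions, so
    [G], being a weak gradient of [0], is orthogonal to all of them; but they
    tend to [G]. *)
Lemma H10_gradient_null G : H10_gradient Omega 0 G -> L2v_inner Omega G G = 0.
Proof.
have S := L2_semi_inner; have Sv := L2v_semi_inner.
move=> [[L0 wG] [phi [tphi _ Gphi]]].
have LG i : L2 Omega (G i) by have [] := wG i.
pose dphi k : 'I_d -> V -> R := fun i => partial i (phi k).
have Ldphi k i : L2 Omega (dphi k i).
  exact: test_function_L2 (test_function_partial i (tphi k)).
have orth k : L2v_inner Omega G (dphi k) = 0.
  apply: big1 => i _; have tp := test_function_partial i (tphi k).
  apply/eqP; rewrite -oppr_eq0 -((wG i).2 _ tp) (si_0l S)//.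
  exact: test_function_L2 (test_function_partial i tp).
have le k : L2v_inner Omega G G <=
    L2v_norm Omega G * L2v_norm Omega (fun i => G i \- partial i (phi k)).
  apply: le_trans (cauchy_schwarz Sv LG (si_sub Sv LG (Ldphi k))).
  by rewrite (si_sub_r Sv) ?orth ?subr0 ?ler_norm.
apply/eqP; rewrite eq_le (si_ge0 Sv)// andbT.
rewrite -(mulr0 (L2v_norm Omega G)).
apply: (ler_cvg_to (cvg_cst (L2v_inner Omega G G))
  (@cvgMl_tmp _ _ _ _ _ (L2v_norm Omega G) _ Gphi)).
exact: nearW.
Qed.

Lemma gradP u : H10 Omega u -> H10_gradient Omega u (grad Omega u).
Proof. by move=> [G uG]; apply: (xgetPex _ (ex_intro _ G uG)). Qed.

Lemma H10_L2 : H10 Omega `<=` L2 Omega.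
Proof. by move=> u [G [[]]]. Qed.

(** This makes [dirichlet] independent of the gradient chosen by [grad], hence
    bilinear although that choice is not linear. *)
Lemma H10_gradient_ae_unique u G H (K : 'I_d -> V -> R) :
  H10_gradient Omega u G -> H10_gradient Omega u H ->
  (forall i, L2 Omega (K i)) -> L2v_inner Omega G K = L2v_inner Omega H K.
Proof.
move=> uG uH LK; have Sv := L2v_semi_inner.
have LG i : L2 Omega (G i) by have [[_ /(_ i)[]]] := uG.
have LH i : L2 Omega (H i) by have [[_ /(_ i)[]]] := uH.
have := H10_gradient_comb (-1) uH uG;
  rewrite !scaleN1r addNr => /H10_gradient_null.
rewrite addrC => /(si_null Sv (si_sub Sv LG LH) LK).
by rewrite (si_sub_l Sv)// => /eqP; rewrite subr_eq0 => /eqP.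
Qed.

Lemma H10_semi_inner : semi_inner (H10 Omega) (dirichlet Omega).
Proof.
have Sv := L2v_semi_inner.
have Lgrad u : H10 Omega u -> forall i, L2 Omega (grad Omega u i).
  by move=> /gradP[[_ +] _] i => /(_ i)[].
have comb (a : R) u w : H10 Omega u -> H10 Omega w ->
    H10_gradient Omega (a *: u + w) (a *: grad Omega u + grad Omega w).
  by move=> /gradP Hu /gradP Hw; exact: H10_gradient_comb.
split.
- by exists 0; exact: H10_gradient0.
- by move=> a u w Hu Hw; eexists; exact: comb.
- move=> a u w z Hu Hw Hz; rewrite /dirichlet.
  have au : H10 Omega (a *: u + w) by eexists; exact: comb.
  rewrite (H10_gradient_ae_unique (gradP au) (comb a u w Hu Hw))//;
    last exact: Lgrad.
  by apply: (si_lin Sv a); exact: Lgrad.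
- by move=> u w Hu Hw; apply: (si_sym Sv); exact: Lgrad.
- by move=> u Hu; apply: (si_ge0 Sv); exact: Lgrad.
Qed.

End sobolev_spaces.

(** * Finite element functions *)

Section finite_element_functions.
Context (R : realType) (d : nat) (Omega : set 'rV[R]_d).
Hypotheses (oOmega : open Omega) (bOmega : bounded_set Omega).
Context (M : seq 'M[R]_(d.+1, d)).
Hypothesis MOmega : covered M `<=` closure Omega.
Local Notation S := (fe_space Omega M).
Implicit Types (u chi : 'rV[R]_d -> R).

Lemma fe_H10 : S `<=` H10 Omega. Proof. by move=> u []. Qed.

Lemma fe_comb (a : R) u w : S u -> S w -> S (a *: u + w).
Proof.
move=> [Hu cu Au u0] [Hw cw Aw w0]; split.
- exact: (si_comb (H10_semi_inner oOmega bOmega)).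
- exact: continuous_comb.
- move=> A AM; have [b [c ub]] := Au A AM; have [b' [c' wb]] := Aw A AM.
  exists (a *: b + b'), (a * c + c') => x Ax.
  rewrite (_ : (a *: u + w) x = a * u x + w x)// ub// wb//.
  by rewrite mulmxDr -scalemxAr !mxE; ring.
- move=> x Mx; rewrite (_ : (a *: u + w) x = a * u x + w x)// u0// w0//.
  by rewrite mulr0 addr0.
Qed.

Lemma fe0 : S 0.
Proof.
split=> //; first exact: (si_zero (H10_semi_inner oOmega bOmega)).
- exact: cst_continuous.
- by move=> A _; exists 0, 0 => x _; rewrite mulmx0 mxE addr0.
Qed.

(** A finite element function vanishing almost everywhere on the domain
    vanishes on it by continuity, hence on its closure, which contains all
    simplices. *)
Lemma fe_definite chi : S chi -> L2_inner Omega chi chi = 0 -> chi = 0.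
Proof.
move=> [/(H10_L2) L2chi cchi _ chi0] null.
have mD := measurable_open_vec oOmega.
have ae0 := sqint_null mD L2chi null.
have Omega0 := open_ae oOmega cchi ae0.
apply/funext => x; have [/MOmega Mx|/chi0 //] := pselect (covered M x).
have : closed (chi @^-1` [set 0]).
  by apply: closed_comp => //; exact: closed_eq.
move/closure_id => cl; suff : closure (chi @^-1` [set 0]) x by rewrite -cl.
move: Mx; apply: closureS => y Oy; apply: Omega0; exact: mem_set.
Qed.

Definition vertices := [seq row i A | A <- M, i <- enum 'I_d.+1].

Definition nodal_values chi : 'rV[R]_(size vertices) :=
  \row_k chi (nth 0 vertices k).

Lemma nodal_values_comb (a : R) u w :
  nodal_values (a *: u + w) = a *: nodal_values u + nodal_values w.
Proof. by apply/rowP => k; rewrite !mxE. Qed.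

(** An affine function on a simplex is the barycentric mean of its values at the
    vertices. *)
Lemma nodal_values_inj chi : S chi -> nodal_values chi = 0 -> chi = 0.
Proof.
move=> [_ _ Achi chi0] /rowP nodal0.
have v0 A i : A \in M -> chi (row i A) = 0.
  move=> AM; have vA : row i A \in vertices.
    by apply/allpairsP; exists (A, i); rewrite mem_enum.
  have kv : (index (row i A) vertices < size vertices)%N by rewrite index_mem.
  by have := nodal0 (Ordinal kv); rewrite !mxE/= nth_index.
apply/funext => x; have [[A AM Ax]|/chi0 //] := pselect (covered M x).
have [b [c chiE]] := Achi A AM; rewrite chiE//.
have rowA i : simplex A (row i A).
  exists (delta_mx 0 i); last by rewrite rowE.
  split=> // [j|]; first by rewrite mxE ler0n.
  rewrite (bigD1 i)//= mxE !eqxx big1 ?addr0// => j ji.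
  by rewrite mxE (negbTE ji).
case: Ax => l [l0 l1 _] <-.
have rb i : (row i A *m b) 0 0 = - c.
  by have := chiE _ (rowA i); rewrite v0// => /esym/eqP;
    rewrite addr_eq0 => /eqP.
rewrite [l *m A]mulmx_sum_row mulmx_suml summxE.
have lE i : ((l 0 i *: row i A) *m b) 0 0 = l 0 i * - c.
  by rewrite -scalemxAl mxE rb.
rewrite (eq_bigr _ (fun i _ => lE i)).
by rewrite -mulr_suml l1 mul1r addNr.
Qed.

End finite_element_functions.

(** * Superposition with locally Lipschitz functions *)

Section superposition.
Context (R : realType).

Definition locally_lipschitz (g : R -> R) : Prop := forall r, 0 < r ->
  exists2 L, 0 < L & forall z1 z2, - r <= z1 <= r -> - r <= z2 <= r ->
    `|g z1 - g z2| <= L * `|z1 - z2|.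

Lemma assumption_A_lipschitz f : assumption_A f ->
  locally_lipschitz f /\ locally_lipschitz (derive1 f).
Proof.
move=> [_ fL]; split=> r r0; have [L L0 LP] := fL r r0;
  exists L => // z1 z2 h1 h2.
  by apply: le_trans (LP _ _ h1 h2); rewrite lerDl.
by apply: le_trans (LP _ _ h1 h2); rewrite lerDr.
Qed.

Lemma locally_lipschitz_continuous (g : R -> R) : locally_lipschitz g ->
  continuous g.
Proof.
move=> gL z; have r0 : 0 < `|z| + 1 by have := normr_ge0 z; lra.
have [L L0 LP] := gL _ r0.
have zr : - (`|z| + 1) <= z <= `|z| + 1.
  by rewrite -ler_norml; lra.
apply/cvgrPdist_lt => e e0.
have eL : 0 < e / L by exact: divr_gt0.
near=> y.
have yz : `|z - y| < e / L by near: y; exact: cvgr_dist_lt.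
have y1 : `|z - y| < 1 by near: y; exact: cvgr_dist_lt.
apply: le_lt_trans (LP _ _ zr _) _.
  rewrite -ler_norml -[y](subKr z); apply: le_trans (ler_normB _ _) _.
  by rewrite lerD2l ltW.
by rewrite -ltr_pdivlMl// mulrC.
Unshelve. all: by end_near. Qed.

Lemma locally_lipschitz_bounded g (r : R) : locally_lipschitz g -> 0 < r ->
  exists2 B, 0 < B & forall z, `|z| <= r -> `|g z| <= B.
Proof.
move=> gL r0; have [L L0 LP] := gL _ r0.
have Lr : 0 < L * r by exact: mulr_gt0.
exists (`|g 0| + L * r); first by have := normr_ge0 (g 0); lra.
move=> z zr; rewrite -[g z](subKr (g 0)); apply: le_trans (ler_normB _ _) _.
rewrite lerD2l; apply: (@le_trans _ _ (L * `|0 - z|)).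
  apply: LP; last by rewrite -ler_norml.
  by apply/andP; split; lra.
by rewrite sub0r normrN ler_pM2l.
Qed.

Context (d : nat) (Omega : set 'rV[R]_d).
Hypotheses (oOmega : open Omega) (bOmega : bounded_set Omega).
Local Notation leb := (lebesgue_tuple R d).
Local Notation D := (@vec R d @^-1` Omega).
Let mD : measurable D. Proof. exact: measurable_open_vec. Qed.
Implicit Types (u v : 'rV[R]_d -> R).

Lemma Linf_norm_ae u (C : R) : (Linf_norm Omega u <= C%:E)%E ->
  {ae leb, forall t, D t -> `|u (vec t)| <= C}.
Proof.
rewrite /Linf_norm unlock; case: ifPn => [_ /ess_supP|].
  apply: filterS => t /= + Dt.
  by rewrite patchE mem_set//= lee_fin.
rewrite -leNgt => leb0 _.
have lebT : leb setT = 0%E by apply/eqP; rewrite eq_le leb0 measure_ge0.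
by exists setT; split.
Qed.

Lemma L2_cst (c : R) : L2 Omega (fun=> c).
Proof. exact: sqint_cst (bounded_vec_finite oOmega bOmega). Qed.

Lemma L2_superposition_mul (g : R -> R) u v (r B : R) : continuous g ->
  L2 Omega u ->
  (Linf_norm Omega u <= r%:E)%E -> 0 <= B ->
  (forall z, `|z| <= r -> `|g z| <= B) -> L2 Omega v ->
  L2 Omega (fun x => g (u x) * v x) /\
  L2_inner Omega (fun x => g (u x) * v x) (fun x => g (u x) * v x)
    <= B ^+ 2 * L2_inner Omega v v.
Proof.
move=> cg [mu _] ur B0 gB Lv.
have mg : measurable_fun D (fun t => g (u (vec t))).
  by apply: (measurableT_comp (continuous_measurable_fun cg)).
have gb : {ae leb, forall t, D t -> `|g (u (vec t))| <= B}.
  by apply: filterS (Linf_norm_ae ur) => t ut /ut; exact: gB.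
split; first exact: (sqint_mul_bounded mD B0 mg gb Lv).
exact: (ip_mul_bounded mD B0 mg gb Lv).
Qed.

Lemma L2_superposition (g : R -> R) u (r B : R) : continuous g -> L2 Omega u ->
  (Linf_norm Omega u <= r%:E)%E -> 0 <= B ->
  (forall z, `|z| <= r -> `|g z| <= B) ->
  L2 Omega (g \o u) /\ L2_inner Omega (g \o u) (g \o u)
    <= B ^+ 2 * L2_inner Omega (fun=> 1) (fun=> 1).
Proof.
move=> cg Lu ur B0 gB.
have := L2_superposition_mul cg Lu ur B0 gB (L2_cst 1).
by rewrite (_ : (fun x => g (u x) * 1) = g \o u)//; apply/funext => x;
  rewrite mulr1.
Qed.

End superposition.

(** * The fully discrete scheme *)

Lemma energy_induction_step (R : realDomainType) (n : nat) (K s x y : R) :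
  x <= y + s -> y <= K + n%:R * s -> x <= K + n.+1%:R * s.
Proof. by rewrite -natr1 mulrDl mul1r; lra. Qed.

Section scheme_steps.
Context (R : realType) (d : nat) (Omega : set 'rV[R]_d).
Hypotheses (oOmega : open Omega) (bOmega : bounded_set Omega).
Context (S : set ('rV[R]_d -> R)).
Hypotheses (S0 : S 0) (SZ : forall a x y, S x -> S y -> S (a *: x + y)).
Hypothesis SH : S `<=` H10 Omega.
Context (beta gamma tau K2 : R).
Hypotheses (beta0 : 0 < beta) (gamma0 : 0 < gamma) (tau0 : 0 < tau).
Context (f : R -> R) (r B0 B1 : R).
Hypotheses (cf : continuous f) (cf' : continuous (derive1 f)).
Hypotheses (B00 : 0 <= B0) (fB : forall z, `|z| <= r -> `|f z| <= B0).
Hypotheses (B10 : 0 <= B1) (f'B : forall z, `|z| <= r -> `|derive1 f z| <= B1).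
Local Notation ip := (L2_inner Omega).
Local Notation dir := (dirichlet Omega).
Implicit Types (u v : 'rV[R]_d -> R).

Let Eip := L2_semi_inner oOmega.
Let Hdir := H10_semi_inner oOmega bOmega.
Let SE : S `<=` L2 Omega.
Proof. by move=> u Su; exact: H10_L2 (SH Su). Qed.

Lemma u_step_linear uold vold u : u_step Omega S beta tau f uold vold u <->
  linear_step ip dir S beta 2 tau uold vold (f \o uold) u.
Proof.
rewrite /u_step /linear_step (_ : (fun x => _ / tau) = tau^-1 *: (u - uold))//.
by apply/funext => x; rewrite mulrC.
Qed.

Lemma v_step_linear uold vold vs : v_step Omega S gamma tau f uold vold vs <->
  linear_step ip dir S gamma 1 tau vold vold
    (fun x => derive1 f (uold x) * vold x) vs.
Proof.
rewrite /v_step /linear_step (_ : (fun x => _ / tau) = tau^-1 *: (vs - vold)).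
  by split=> -[Sv vE]; split=> // chi /vE; rewrite !mul1r.
by apply/funext => x; rewrite mulrC.
Qed.

Lemma normalized_facts z w : S z -> normalized Omega z w ->
  [/\ S w, ip w w = 1 & dir w w = dir z z / ip z z].
Proof.
move=> Sz [z0 wE]; have zE := SE Sz; have zH := SH Sz.
have -> : w = (L2_norm Omega z)^-1 *: z.
  by rewrite wE; apply/funext => x; rewrite mulrC.
have zz : L2_norm Omega z ^+ 2 = ip z z by exact: (sqr_nrm Eip zE).
have zz0 : ip z z != 0 by rewrite -zz expf_neq0.
split.
- by rewrite -[_ *: _]addr0; exact: SZ.
- rewrite (si_scale_l Eip) ?(si_scale_r Eip)//; last exact: (si_scale Eip).
  by rewrite mulrA -expr2 exprVn zz mulVf.
- rewrite (si_scale_l Hdir) ?(si_scale_r Hdir)//; last exact: (si_scale Hdir).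
  by rewrite mulrA -expr2 exprVn zz mulrC.
Qed.

Section one_step.
Context (uold vold : 'rV[R]_d -> R).
Hypotheses (Su : S uold) (ur : (Linf_norm Omega uold <= r%:E)%E).
Hypotheses (Sv : S vold) (v1 : ip vold vold = 1).

Let u_source := L2_superposition oOmega bOmega cf (SE Su) ur B00 fB.
Let v_source := L2_superposition_mul oOmega cf' (SE Su) ur B10 f'B (SE Sv).

Lemma v_step_energy vs : v_step Omega S gamma tau f uold vold vs ->
  [/\ S vs, 1 <= ip vs vs &
    dir vs vs + (gamma * tau)^-1 * (ip vs vs - 1)
      <= dir vold vold + gamma * tau * B1 ^+ 2].
Proof.
move=> /v_step_linear vvs; have [Svs _] := vvs.
have [Lg gB] := v_source; rewrite v1 mulr1 in gB.
have eqn := sqr_norm_step Eip Hdir SZ SE SH gamma0 tau0 Sv v1 vvs.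
have nrg := normalised_step_energy Eip Hdir SZ SE SH gamma0 tau0 Sv v1 Lg vvs.
split=> //.
  by rewrite eqn lerDl (si_ge0 Eip)//; apply: (si_sub Eip); exact: SE.
have -> : ip vs vs - 1 = ip (vs - vold) (vs - vold).
  by rewrite eqn; move: (ip (vs - vold) _) => x; ring.
apply: le_trans nrg _; rewrite lerD2l; apply: ler_wpM2l gB.
by rewrite mulr_ge0// ltW.
Qed.

(** The energy inequality divided by its coefficient: [1 / (1 - 4 x)] is at most
    [1 + 8 x] when [8 x <= 1]. *)
Lemma u_step_energy (F : R) u : F = B0 ^+ 2 * ip (fun=> 1) (fun=> 1) ->
  dir vold vold <= K2 -> 8 * (beta * tau) * K2 <= 1 ->
  u_step Omega S beta tau f uold vold u ->
  S u /\ dir u u <=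
    (1 + 8 * (beta * tau) * K2) * (dir uold uold + 10 * (beta * tau) * F).
Proof.
move=> FE vK small /u_step_linear uu; have [Su' _] := uu; split=> //.
have [Lg gF] := u_source; rewrite -FE in gF.
have := energy_step Eip Hdir SZ SE SH beta0 tau0 Sv v1 Su Lg vK gF uu.
have U0 := si_ge0 Hdir (SH Su').
have K0 : 0 <= K2 by apply: le_trans vK; exact: (si_ge0 Hdir (SH Sv)).
have : 0 <= beta * tau * K2 by rewrite !mulr_ge0// ltW.
move: (dir u u) U0 (dir uold uold + _) small => U U0 Z.
rewrite -!mulrA; move: (beta * (tau * K2)) => x small x0 UZ.
have : (1 + 8 * x) * ((1 - 4 * x) * U) <= (1 + 8 * x) * Z.
  by rewrite ler_wpM2l//; lra.
apply: le_trans; have : 0 <= x * U by exact: mulr_ge0.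
nra.
Qed.

Section well_posed.
Hypothesis Sdef : forall w, S w -> ip w w = 0 -> w = 0.
Hypotheses (vK : dir vold vold <= K2) (betaK : beta * tau * K2 < 1)
  (gammaK : gamma * tau * K2 < 1).

Let k2 : 0 <= (2 : R) <= 2. Proof. by apply/andP; split. Qed.
Let k1 : 0 <= (1 : R) <= 2. Proof. by apply/andP; split; lra. Qed.

Lemma scheme_step_exists n (ev : ('rV[R]_d -> R) -> 'rV[R]_n) :
  (forall c x y, S x -> S y -> ev (c *: x + y) = c *: ev x + ev y) ->
  (forall x, S x -> ev x = 0 -> x = 0) ->
  exists u vs v, [/\ u_step Omega S beta tau f uold vold u,
    v_step Omega S gamma tau f uold vold vs, S v & normalized Omega vs v].
Proof.
move=> evl evi.
have [u uu] := linear_step_exists Eip Hdir S0 SZ SE SH beta0 tau0 k2 Sv v1 vK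
  betaK Sdef evl evi Su u_source.1.
have [vs vvs] := linear_step_exists Eip Hdir S0 SZ SE SH gamma0 tau0 k1 Sv v1 vK
  gammaK Sdef evl evi Sv v_source.1.
have /v_step_energy[Svs vs1 _] := (v_step_linear uold vold vs).2 vvs.
have nvs : normalized Omega vs (fun x => vs x / L2_norm Omega vs).
  split=> //; rewrite sqrtr_eq0 -ltNge; exact: lt_le_trans vs1.
exists u, vs, (fun x => vs x / L2_norm Omega vs); split=> //.
- exact/u_step_linear.
- exact/v_step_linear.
- by have [] := normalized_facts Svs nvs.
Qed.

Lemma scheme_step_unique u u' vs vs' :
  u_step Omega S beta tau f uold vold u ->
    u_step Omega S beta tau f uold vold u' ->
  v_step Omega S gamma tau f uold vold vs ->
  v_step Omega S gamma tau f uold vold vs' -> u = u' /\ vs = vs'.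
Proof.
move=> /u_step_linear uu /u_step_linear uu'.
move=> /v_step_linear vv /v_step_linear vv'.
split.
  exact: (linear_step_unique Eip Hdir SZ SE SH beta0 tau0 k2 Sv v1 vK betaK Sdef
    Su u_source.1 uu uu').
exact: (linear_step_unique Eip Hdir SZ SE SH gamma0 tau0 k1 Sv v1 vK gammaK Sdef
    Sv v_source.1 vv vv').
Qed.

End well_posed.
End one_step.

Section trajectories.
Context (P : ('rV[R]_d -> R) -> 'rV[R]_d -> R) (u0 v0 : 'rV[R]_d ->
  R) (N : nat).
Hypotheses (SPu : S (P u0)) (SPv : S (P v0)).
Local Notation sol := (scheme_solution Omega S P beta gamma tau f u0 v0).
(** Partial solutions are covered as well: the bound at level [m] is needed to
    construct level [m + 1]. *)
Hypothesis sol_bounded : forall m (u vs v : nat -> 'rV[R]_d -> R),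
  (m <= N)%N -> sol m u vs v ->
  forall n, (n <= m)%N -> (Linf_norm Omega (u n) <= r%:E)%E.
Context (K0 : R).
Hypothesis v0K : dir (P v0) (P v0) / ip (P v0) (P v0) <= K0.
Hypothesis K2E : K2 = K0 + N%:R * (gamma * tau * B1 ^+ 2).

Let step0 : 0 <= gamma * tau * B1 ^+ 2.
Proof. by rewrite !mulr_ge0 ?exprn_ge0// ltW. Qed.

(** Dividing by [|v*| >= 1] does not increase the energy, so that the increments
    of one step simply add up. *)
Lemma scheme_v_bounds m (u vs v : nat -> 'rV[R]_d -> R) : (m <= N)%N ->
  sol m u vs v ->
  forall n, (n <= m)%N -> [/\ S (u n), S (v n), ip (v n) (v n) = 1 &
    dir (v n) (v n) <= K0 + n%:R * (gamma * tau * B1 ^+ 2)].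
Proof.
move=> mN msol; have bnd := sol_bounded mN msol.
have [u0E v0E step] := msol; elim=> [_|n IH nm].
  have [Sv v1 vE] := normalized_facts SPv v0E.
  by split=> //; [rewrite u0E|rewrite mul0r addr0 vE].
have [Sun Svn vn1 vnK] := IH (ltnW nm).
have [[Su' _] vst Sv' nv] := step _ nm.
have [Svs vs1 nrg] := v_step_energy Sun (bnd _ (ltnW nm)) Svn vn1 vst.
have [_ v1 vE] := normalized_facts Svs nv; split=> //.
have Dvs := si_ge0 Hdir (SH Svs).
have gt0 : 0 < (gamma * tau)^-1 by rewrite invr_gt0 mulr_gt0.
rewrite vE; apply: (@le_trans _ _ (dir (vs n.+1) (vs n.+1))).
  by rewrite ler_pdivrMr ?ler_peMr// (lt_le_trans ltr01).
apply: le_trans (energy_induction_step nrg vnK).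
by rewrite lerDl mulr_ge0 ?(ltW gt0)// subr_ge0.
Qed.

Lemma scheme_v_bound m (u vs v : nat -> 'rV[R]_d -> R) : (m <= N)%N ->
  sol m u vs v ->
  forall n, (n <= m)%N -> dir (v n) (v n) <= K2.
Proof.
move=> mN msol n nm; have [_ _ _] := scheme_v_bounds mN msol nm.
move=> /le_trans; apply; rewrite K2E lerD2l ler_wpM2r// ler_nat.
exact: leq_trans mN.
Qed.

Lemma scheme_vs_bounds m (u vs v : nat -> 'rV[R]_d -> R) : (m <= N)%N ->
  sol m u vs v ->
  forall n, (n < m)%N -> [/\ 1 <= ip (vs n.+1) (vs n.+1),
    dir (vs n.+1) (vs n.+1) <= K2 &
    ip (vs n.+1) (vs n.+1) - 1 <= gamma * tau * K2].
Proof.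
move=> mN msol n nm; have bnd := sol_bounded mN msol.
have [Sun Svn vn1 vnK] := scheme_v_bounds mN msol (ltnW nm).
have [_ _ /(_ _ nm)[_ vst _ _]] := msol.
have [Svs vs1 nrg] := v_step_energy Sun (bnd _ (ltnW nm)) Svn vn1 vst.
have Dvs := si_ge0 Hdir (SH Svs).
have gt0 : 0 < gamma * tau by rewrite mulr_gt0.
have nK2 : K0 + n.+1%:R * (gamma * tau * B1 ^+ 2) <= K2.
  by rewrite K2E lerD2l ler_wpM2r// ler_nat (leq_trans nm).
have vsK := le_trans (energy_induction_step nrg vnK) nK2.
have e0 : 0 <= (gamma * tau)^-1 * (ip (vs n.+1) (vs n.+1) - 1).
  by rewrite mulr_ge0 ?invr_ge0 ?(ltW gt0)// subr_ge0.
split=> //; first by apply: le_trans vsK; rewrite lerDl.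
by rewrite -ler_pdivrMl//; apply: le_trans vsK; rewrite lerDr.
Qed.

Lemma scheme_u_bound (F : R) (u vs v : nat -> 'rV[R]_d -> R) :
  F = B0 ^+ 2 * ip (fun=> 1) (fun=> 1) ->
  8 * (beta * tau) * K2 <= 1 -> sol N u vs v ->
  forall n, (n <= N)%N -> dir (u n) (u n) <=
    expR (N%:R * (8 * (beta * tau) * K2))
      * (dir (P u0) (P u0) + N%:R * (10 * (beta * tau) * F)).
Proof.
move=> FE small Nsol; have bnd := sol_bounded (leqnn N) Nsol.
have [u0E v0E step] := Nsol.
have vb := scheme_v_bounds (leqnn N) Nsol.
have vK := scheme_v_bound (leqnn N) Nsol.
have bt0 : 0 < beta * tau by exact: mulr_gt0.
have K20 : 0 <= K2.
  have [_ Sv _ _] := vb _ (leq0n N).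
  by apply: le_trans (vK _ (leq0n N)); exact: (si_ge0 Hdir (SH Sv)).
have F0 : 0 <= F.
  rewrite FE mulr_ge0 ?exprn_ge0//; apply: (si_ge0 Eip); exact: L2_cst.
rewrite -u0E => n; apply: (discrete_gronwall (y := fun n => dir (u n) (u n))).
- by rewrite !mulr_ge0// ltW.
- by rewrite !mulr_ge0// ltW.
- by rewrite u0E; exact: (si_ge0 Hdir (SH SPu)).
move=> k kN; have [Su Sv v1 _] := vb _ (ltnW kN).
have [ust _ _ _] := step _ kN.
by have [] :=
  u_step_energy Su (bnd _ (ltnW kN)) Sv v1 FE (vK _ (ltnW kN)) small ust.
Qed.

Hypothesis Sdef : forall w, S w -> ip w w = 0 -> w = 0.
Hypotheses (betaK : beta * tau * K2 < 1) (gammaK : gamma * tau * K2 < 1).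

Lemma scheme_unique (u vs v u' vs' v' : nat -> 'rV[R]_d -> R) :
  sol N u vs v -> sol N u' vs' v' ->
  forall n, (n <= N)%N ->
    [/\ u' n = u n, v' n = v n & (0 < n)%N -> vs' n = vs n].
Proof.
move=> Nsol Nsol'; have bnd := sol_bounded (leqnn N) Nsol.
have vb := scheme_v_bounds (leqnn N) Nsol.
have vK := scheme_v_bound (leqnn N) Nsol.
have [u0E [_ v0E] step] := Nsol; have [u0E' [_ v0E'] step'] := Nsol'.
elim=> [_|n IH nN]; first by rewrite u0E u0E' v0E v0E'.
have [uE vE _] := IH (ltnW nN); have [Su Sv v1 _] := vb _ (ltnW nN).
have [ust vst _ [_ vn]] := step _ nN.
have [ust' vst' _ [_ vn']] := step' _ nN.
rewrite uE vE in ust' vst'.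
have [uE' vsE] := scheme_step_unique Su (bnd _ (ltnW nN)) Sv v1 Sdef
  (vK _ (ltnW nN)) betaK gammaK ust' ust vst' vst.
by split=> //; rewrite vn vn' vsE.
Qed.

Lemma scheme_exists n (ev : ('rV[R]_d -> R) -> 'rV[R]_n) :
  (forall c x y, S x -> S y -> ev (c *: x + y) = c *: ev x + ev y) ->
  (forall x, S x -> ev x = 0 -> x = 0) ->
  L2_norm Omega (P v0) != 0 ->
  forall m, (m <= N)%N ->
  exists u vs v : nat -> 'rV[R]_d -> R, sol m u vs v.
Proof.
move=> evl evi Pv0; elim=> [_|m IH mN].
  by exists (fun=> P u0), (fun=> 0), (fun=> fun x =>
    P v0 x / L2_norm Omega (P v0)).
have [u [vs [v msol]]] := IH (ltnW mN).
have bnd := sol_bounded (ltnW mN) msol (leqnn m).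
have [Su Sv v1 _] := scheme_v_bounds (ltnW mN) msol (leqnn m).
have vK := scheme_v_bound (ltnW mN) msol (leqnn m).
have [u' [vs' [v' [ust vst Sv' nv]]]] :=
  scheme_step_exists Su bnd Sv v1 Sdef vK betaK gammaK evl evi.
have [u0E v0E step] := msol.
pose ext (x : nat -> 'rV[R]_d -> R) (y : 'rV[R]_d -> R) k :=
  if k == m.+1 then y else x k.
have extE x y k : (k <= m)%N -> ext x y k = x k.
  by move=> km; rewrite /ext ltn_eqF.
have extS x y : ext x y m.+1 = y by rewrite /ext eqxx.
exists (ext u u'), (ext vs vs'), (ext v v'); split; rewrite ?extE//.
move=> k; rewrite ltnS leq_eqVlt => /predU1P[->|km].
  by rewrite !extS !extE.
by rewrite !extE ?(ltnW km)//; exact: step.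
Qed.

End trajectories.
End scheme_steps.

(** * The a priori bounds *)

(** The threshold [(2 (C + 1))^-1] rather than [(2 C)^-1] covers [C = 0]. *)
Lemma small_mesh (R : realFieldType) (C h : R) : 0 <= C -> 0 < h -> h < 1 ->
  h < (2 * (C + 1))^-1 -> C * h ^+ 2 <= 2^-1.
Proof.
move=> C0 h0 h1; have c0 : 0 < 2 * (C + 1) by lra.
rewrite -(ltr_pM2l c0) mulfV ?gt_eqF// => hC.
have : h ^+ 2 <= h by rewrite expr2 ler_piMr// ltW.
have : 0 <= C * h by rewrite mulr_ge0// ltW.
nra.
Qed.

Lemma small_step (R : realFieldType) (b g K t : R) : 0 < b -> 0 < g -> 0 < K ->
  0 < t -> t < (8 * (b + g) * K)^-1 ->
  [/\ 8 * (b * t) * K <= 1, b * t * K < 1 & g * t * K < 1].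
Proof.
move=> b0 g0 K0 t0;
  have c0 : 0 < 8 * (b + g) * K by rewrite !mulr_gt0// addr_gt0.
rewrite -(ltr_pM2l c0) mulfV ?gt_eqF// => small.
have bt : 0 < b * t * K by rewrite !mulr_gt0.
have gt : 0 < g * t * K by rewrite !mulr_gt0.
by split; nra.
Qed.

Lemma small_perturbation (R : realFieldType) (e x y c : R) : 1 <= e + x ->
  e + y <= c -> 0 <= y -> c <= 2^-1 -> 2^-1 <= x.
Proof. by lra. Qed.

Lemma quotient_le (R : realFieldType) (a b x : R) : 0 <= b -> a <= b ->
  2^-1 <= x -> a / x ^+ 2 <= 4 * b.
Proof.
move=> b0 ab x2; have x0 : 0 < x ^+ 2 by rewrite exprn_gt0//; lra.
rewrite ler_pdivrMr//; have : 1 <= 4 * x ^+ 2 by nra.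
nra.
Qed.

Lemma dist_sqr1 (R : realDomainType) (x : R) : 0 <= x ->
  `|x - 1| <= `|x ^+ 2 - 1|.
Proof.
move=> x0; rewrite (_ : x ^+ 2 - 1 = (x - 1) * (x + 1)); last by ring.
by rewrite normrM ler_peMr// ger0_norm; lra.
Qed.

Theorem theorem4p1 (R : realType) (d : nat) (hd : (1 <= d <= 3)%N)
    (Omega : set 'rV[R]_d) (hOmega : smooth_bounded_domain Omega)
    (beta gamma T : R) (hbeta : 0 < beta) (hgamma : 0 < gamma) (hT : 0 < T)
    (f : R -> R) (hA : assumption_A f)
    (u0 v0 : 'rV[R]_d -> R)
    (hu0 : H2 Omega u0 /\ H10 Omega u0) (hv0 : H2 Omega v0 /\ H10 Omega v0)
    (hv0n : L2_norm Omega v0 = 1)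
    (C1 : R) (hC1 : 0 < C1) :
  exists2 Q : R, 0 < Q &
  forall (hbar rho kappa CP : R) (M : R -> seq 'M[R]_(d.+1, d))
         (P : R -> ('rV[R]_d -> R) -> 'rV[R]_d -> R),
    0 < hbar -> 0 < rho -> 0 < kappa -> 0 < CP ->
    (forall h, 0 < h < hbar -> quasi_uniform_mesh Omega rho kappa h (M h)) ->
    (forall h, 0 < h < hbar ->
       elliptic_projection Omega (fe_space Omega (M h)) (P h)) ->
    (forall h, 0 < h < hbar -> projection_estimate Omega h CP (P h)) ->
  forall h0 tau0 : R, 0 < h0 -> 0 < tau0 ->
    assumption_C Omega hbar (fun h => fe_space Omega (M h)) P beta gamma T f
      u0 v0 h0 tau0 C1 ->
  exists h1 tau1 : R, [/\ 0 < h1 <= hbar, 0 < tau1 &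
  forall (h : R) (N : nat), 0 < h < h1 -> (0 < N)%N -> T / N%:R < tau1 ->
    let sol := scheme_solution Omega (fe_space Omega (M h)) (P h) beta gamma
                 (T / N%:R) f u0 v0 N in
    exists u vs v : nat -> 'rV[R]_d -> R,
      [/\ sol u vs v,
          forall u' vs' v', sol u' vs' v' ->
            forall n, (1 <= n <= N)%N ->
              [/\ u' n = u n, vs' n = vs n & v' n = v n] &
          forall n, (1 <= n <= N)%N ->
            [/\ grad_norm Omega (u n) + grad_norm Omega (v n)
                  + grad_norm Omega (vs n) <= Q,
                `|L2_norm Omega (vs n) - 1| <= `|L2_norm Omega (vs n) ^+ 2 - 1| &
                `|L2_norm Omega (vs n) ^+ 2 - 1| <= Q * (T / N%:R)]]].
Proof.
have oO := domain_open hOmega; have bO := domain_bounded hOmega.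
have Eip := L2_semi_inner oO; have Hdir := H10_semi_inner oO bO.
have [fL f'L] := assumption_A_lipschitz hA.
have [B0 B00 fB] := locally_lipschitz_bounded fL hC1.
have [B1 B10 f'B] := locally_lipschitz_bounded f'L hC1.
have cf := locally_lipschitz_continuous fL.
have cf' := locally_lipschitz_continuous f'L.
pose F := B0 ^+ 2 * L2_inner Omega (fun=> 1) (fun=> 1).
have F0 : 0 <= F.
  by rewrite mulr_ge0 ?exprn_ge0 ?(ltW B00)//; apply: (si_ge0 Eip);
    exact: L2_cst.
(* The factor 4 comes from [|P v0| >= 1/2], which holds for small [h]. *)
pose K0 := 4 * dirichlet Omega v0 v0.
have K00 : 0 <= K0 by rewrite mulr_ge0//; exact: (si_ge0 Hdir hv0.2).
pose K2 := K0 + gamma * T * B1 ^+ 2.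
have K20 : 0 < K2 by rewrite ltr_wpDl// !mulr_gt0// exprn_gt0.
pose Ku := expR (8 * beta * T * K2)
  * (dirichlet Omega u0 u0 + 10 * beta * T * F).
have Ku0 : 0 <= Ku.
  apply: mulr_ge0; first exact: expR_ge0.
  apply: addr_ge0; first exact: (si_ge0 Hdir hu0.2).
  by apply: mulr_ge0 F0; rewrite !mulr_ge0// ltW.
(* [Ku] and [K2] bound the squared gradient norms; [gamma * K2] is the constant
   for [|v*|^2 - 1]. *)
exists (Num.sqrt Ku + Num.sqrt K2 + Num.sqrt K2 + gamma * K2).
  by rewrite ltr_wpDl ?addr_ge0 ?sqrtr_ge0// mulr_gt0.
move=> hbar rho kappa CP M P hbar0 _ _ CP0 meshM projP estP.
move=> h0 tau0 h00 tau00 hC.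
pose H := H2_norm Omega v0; have H0 : 0 <= H by exact: sqrtr_ge0.
have CH0 : 0 <= CP * H by rewrite mulr_ge0// ltW.
have e0 : 0 < (2 * (CP * H + 1))^-1 by rewrite invr_gt0; lra.
pose h1 := Num.min hbar (Num.min h0 (Num.min 1 (2 * (CP * H + 1))^-1)).
pose tau1 := Num.min tau0 (8 * (beta + gamma) * K2)^-1.
exists h1, tau1; split.
- by rewrite /h1 !lt_min ge_min lexx/= hbar0 h00 ltr01 e0.
- by rewrite /tau1 lt_min tau00/= invr_gt0 !mulr_gt0// addr_gt0.
move=> h N /andP[h_gt0 hh1] N0 Ntau1 sol.
have /and4P[hhbar hh0 hle1 hlee] : [&& h < hbar, h < h0, h < 1
    & h < (2 * (CP * H + 1))^-1] by rewrite /h1 !lt_min in hh1.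
have /andP[tautau0 tausmall] : (T / N%:R < tau0) &&
    (T / N%:R < (8 * (beta + gamma) * K2)^-1) by rewrite /tau1 lt_min in Ntau1.
have hb : 0 < h < hbar by rewrite h_gt0.
have mesh := mesh_sub (meshM h hb).
pose S := fe_space Omega (M h).
have S0 : S 0 by exact: fe0.
have SZ a x y : S x -> S y -> S (a *: x + y) by exact: fe_comb.
have SH : S `<=` H10 Omega by exact: fe_H10.
have Sdef w : S w -> L2_inner Omega w w = 0 -> w = 0 by exact: fe_definite.
have [SPu orthu] := projP h hb u0 hu0.2.
have [SPv orthv] := projP h hb v0 hv0.2.
pose tau := T / N%:R.
have N0' : 0 < (N%:R : R) by rewrite ltr0n.
have tau_gt0 : 0 < tau by exact: divr_gt0.
have Ntau x : N%:R * (tau * x) = T * x.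
  by rewrite /tau mulrA mulrCA mulfV ?gt_eqF// mulr1.
have Nbetatau c x : N%:R * (c * (beta * tau) * x) = c * beta * T * x.
  have -> : N%:R * (c * (beta * tau) * x) =
    N%:R * (tau * (c * beta * x)) by ring.
  by rewrite Ntau; ring.
have dPu : dirichlet Omega (P h u0) (P h u0) <= dirichlet Omega u0 u0.
  exact: (proj_contraction Hdir hu0.2 (SH _ SPu) (orthu _ SPu)).
have dPv : dirichlet Omega (P h v0) (P h v0) <= dirichlet Omega v0 v0.
  exact: (proj_contraction Hdir hv0.2 (SH _ SPv) (orthv _ SPv)).
have Pv_ge : 2^-1 <= L2_norm Omega (P h v0).
  have Lv := H10_L2 hv0.2; have LPv := H10_L2 (SH _ SPv).
  have tri : 1 <= L2_norm Omega (v0 \- P h v0) + L2_norm Omega (P h v0).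
    have := nrm_triangle Eip (si_sub Eip Lv LPv) LPv.
    by rewrite subrK -/(L2_norm Omega v0) hv0n.
  apply: (small_perturbation tri (estP h hb v0 hv0.1 hv0.2)).
    by rewrite mulr_ge0 ?sqrtr_ge0// ltW.
  by rewrite -/H mulrAC; exact: small_mesh.
have Pv_sqr : L2_norm Omega (P h v0) ^+ 2 = L2_inner Omega (P h v0) (P h v0).
  exact: (sqr_nrm Eip (H10_L2 (SH _ SPv))).
have v0K : dirichlet Omega (P h v0) (P h v0)
    / L2_inner Omega (P h v0) (P h v0) <= K0.
  rewrite -Pv_sqr; exact: (quotient_le (si_ge0 Hdir hv0.2) dPv Pv_ge).
have K2E : K2 = K0 + N%:R * (gamma * tau * B1 ^+ 2).
  by rewrite -mulrA mulrCA Ntau mulrA.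
have [smallb betaK gammaK] := small_step hbeta hgamma K20 tau_gt0 tausmall.
have bndC m (u vs v : nat -> 'rV[R]_d -> R) : (m <= N)%N ->
    scheme_solution Omega S (P h) beta gamma tau f u0 v0 m u vs v ->
    forall n, (n <= m)%N -> (Linf_norm Omega (u n) <= C1%:E)%E.
  by move=> mN msol n nm; apply: (hC h N) msol n nm => //; rewrite h_gt0.
have nodal_lin c x y : S x -> S y -> nodal_values (M h) (c *: x + y) =
    c *: nodal_values (M h) x + nodal_values (M h) y.
  by move=> _ _; exact: nodal_values_comb.
have nodal_inj x : S x -> nodal_values (M h) x = 0 -> x = 0.
  exact: nodal_values_inj.
have Pv0 : L2_norm Omega (P h v0) != 0.
  by rewrite gt_eqF// (lt_le_trans _ Pv_ge).
have [u [vs [v Nsol]]] := scheme_exists oO bO S0 SZ SH hbeta hgamma tau_gt0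
  cf cf' (ltW B00) fB (ltW B10) f'B SPu SPv bndC v0K K2E Sdef betaK gammaK
  nodal_lin nodal_inj Pv0 (leqnn N).
exists u, vs, v; split=> //.
  move=> u' vs' v' Nsol' n /andP[n0 nN].
  have [uE vE vsE] := scheme_unique oO bO S0 SZ SH hbeta hgamma tau_gt0
    cf cf' (ltW B00) fB (ltW B10) f'B SPu SPv bndC v0K K2E Sdef betaK gammaK
    Nsol Nsol' nN.
  by split=> //; exact: vsE.
move=> n /andP[n0 nN].
have uK := scheme_u_bound oO bO S0 SZ SH hbeta hgamma tau_gt0 cf cf' (ltW B00)
  fB (ltW B10) f'B SPu SPv bndC v0K K2E (erefl F) smallb Nsol nN.
have vK := scheme_v_bound oO bO S0 SZ SH hgamma tau_gt0 cf' (ltW B10) f'B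
  SPu SPv bndC v0K K2E (leqnn N) Nsol nN.
case: n n0 nN uK vK => // n _ nN uK vK.
have [vs1 vsK vsd] := scheme_vs_bounds oO bO S0 SZ SH hgamma tau_gt0 cf'
  (ltW B10) f'B SPu SPv bndC v0K K2E (leqnn N) Nsol nN.
have uKu : dirichlet Omega (u n.+1) (u n.+1) <= Ku.
  apply: le_trans uK _.
  rewrite !Nbetatau.
  exact: (ler_wpM2l (expR_ge0 _) (lerD dPu (lexx _))).
have Svs : L2 Omega (vs n.+1).
  by have [_ _ /(_ _ nN)[_ [Svs _] _ _]] := Nsol; exact: H10_L2 (SH _ Svs).
have vsE : L2_norm Omega (vs n.+1) ^+ 2 = L2_inner Omega (vs n.+1) (vs n.+1).
  exact: (sqr_nrm Eip Svs).
have gK0 : 0 <= gamma * K2 by rewrite ltW// mulr_gt0.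
split.
- have grads := lerD (lerD (ler_wsqrtr uKu) (ler_wsqrtr vK)) (ler_wsqrtr vsK).
  by apply: le_trans grads _; rewrite lerDl.
- by apply: dist_sqr1; exact: sqrtr_ge0.
- rewrite vsE ger0_norm ?subr_ge0//; apply: le_trans vsd _.
  rewrite mulrAC ler_wpM2r ?(ltW tau_gt0)// lerDr.
  by rewrite !addr_ge0 ?sqrtr_ge0.
Qed.
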